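(* Let $f(z)=\sum_{k=0}^\infty a_k z^k$, with $a_k>0$ for all $k\ge 0$, be an entire function, and for $n\ge 2$ put $q_n(f)=\frac{a_{n-1}^2}{a_{n-2}a_n}$. Suppose that there are real numbers $a,b$ with $1<a<b$ such that $q_2(f)=q_4(f)=q_6(f)=\ldots=a$ and $q_3(f)=q_5(f)=q_7(f)=\ldots=b$. Then $f$ belongs to the Laguerre--Pólya class of type I if and only if there exists a real number $z_0\in\left[-\frac{a_1}{a_2},0\right]$ such that $f(z_0)\le 0$.
   Context: A real entire function $f$ belongs to the Laguerre--Pólya class of type I (written $f\in\mathcal{L-P}I$) if it can be expressed in the form $f(z)=c z^n e^{\beta z}\prod_{k}\left(1+\frac{z}{x_k}\right)$, where $c\in\mathbb{R}$, $\beta\ge 0$, $x_k>0$, $n$ is a nonnegative integer, and $\sum_k x_k^{-1}<\infty$. The product may be infinite, finite, or empty (in the latter case it equals 1). *)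

(* Defs.v *)
From Stdlib Require Import Reals List.
From Coquelicot Require Import Coquelicot.

Open Scope R_scope.

(* A function [C -> C] is real entire when it is the sum of a power series with
   real coefficients that converges on the whole complex plane.  The scalar field
   has to be given: [C] is also a normed module over [R] in Coquelicot. *)
Definition entire_with_coeffs (a : nat -> R) (f : C -> C) : Prop :=
  forall z : C,
    @is_pseries C_AbsRing C_NormedModule (fun k => RtoC (a k)) z (f z).

Definition real_entire (f : C -> C) : Prop :=
  exists a : nat -> R, entire_with_coeffs a f.

(* exp (x + i y) = e^x (cos y + i sin y) *)
Definition Cexp (z : C) : C :=
  (exp (Re z) * cos (Im z), exp (Re z) * sin (Im z)).

Definition zeros_prod (x : nat -> R) (m : nat) (z : C) : C :=
  fold_right Cmult (RtoC 1)
    (map (fun k => (RtoC 1 + z / RtoC (x k))%C) (seq 0 m)).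

(* In the finite case only x_0, ..., x_(m-1) matter, and m = 0 is the empty
   product; the other values of [x] are junk. *)
Definition LaguerrePolya_I (f : C -> C) : Prop :=
  real_entire f /\
  exists (c : R) (n : nat) (beta : R) (x : nat -> R),
    0 <= beta /\
    (forall k, 0 < x k) /\
    ((exists m : nat, forall z : C,
        f z = (RtoC c * Cpow z n * Cexp (RtoC beta * z) * zeros_prod x m z)%C)
     \/
     (ex_series (fun k => / x k) /\
      forall z : C, exists P : C,
        filterlim (fun m => zeros_prod x m z) eventually (locally P) /\
        f z = (RtoC c * Cpow z n * Cexp (RtoC beta * z) * P)%C)).

(* Meaningful for n >= 2 only, because of the truncated subtractions. *)
Definition second_quotient (a : nat -> R) (n : nat) : R :=
  a (n - 1)%nat ^ 2 / (a (n - 2)%nat * a n).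

(* Main.v *)
Require Import Defs.
From Stdlib Require Import Reals Lra Lia Psatz List Classical ClassicalEpsilon.
From Coquelicot Require Import Coquelicot.

Open Scope R_scope.

(** Rescale the variable so that the first two coefficients are 1, and put
    [c = a * b].  Since the second quotients have period 2, the function
    [g x = f (- x)] satisfies [g x = 1 - x + x^2 / a * g (x / c)], and its partial
    sums of odd degree, the polynomials [sect a c k] of degree [2k+1], satisfy the
    same recursion: [sect (k+1)] comes from [sect k].

    If [f] takes a nonpositive value on the given interval, there is [x0] in
    [(1, a]] with [g x0 <= 0]; the sections increase to [g] there, so they are all
    negative at [x0], and by the recursion section number [k] is negative at the
    points [c^i * x0] for [i <= k] ([sect_neg_geometric]).  Reversing the
    coefficients of a section exchanges [a] and [b] and sends [x] to [c^k / x]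
    ([sect_reversal]); because [a < b], the exchanged section lies below the
    original one on the relevant range ([sect_compare]), so it is negative at
    the corresponding point, and reversal turns its negative values into positive
    values of the section at [c^i * a / (b * x0)] ([sect_pos_geometric]).
    Altogether a section of degree [2k+1] has [2k+1] sign changes on the positive
    axis, located in intervals that do not depend on [k] and whose endpoints grow
    geometrically.  Hence it is the product of its linear factors, also as a
    function on the complex plane.  Successive sections are ordered on these
    intervals, so the root in each interval moves monotonically with [k] and
    converges ([sect_root_limits]); dominated convergence of the products
    ([zeros_prod_tannery]) exhibits [f] as the product over the limiting roots.

    Conversely, let [f] be in the class and suppose that all its zeros lie to the
    left of [- a_1 / a_2].  Let [p1, p2, p3] be the power sums of the reciprocals
    of the absolute values of the zeros, with the exponent [beta] of the
    exponential factor added to [p1].  Newton's identities express them through the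
    first four coefficients of [f] ([product_power_sums]).  The position of the
    zeros gives [p2 <= (a_2 / a_1) * p1], that is [a <= 3], while the
    Cauchy-Schwarz inequality [p2^2 <= p1 * p3] says [4 <= a + 3 / b], which with
    [b > a] forces [a > 3].  So some zero lies in the interval, and [f] vanishes
    there. *)

(** * Sections of odd degree and their signs *)

(** The terms of degree [2j] and [2j+1] of [g], taken together: in closed form
    [x^(2j) / (a^j * c^(j(j-1))) * (1 - x / c^j)].  The pair has the sign of
    [1 - x / c^j], which is what the sign analysis needs. *)
Fixpoint pair_term (a c : R) (j : nat) (x : R) : R :=
  match j with
  | O => 1 - x
  | S j' => x ^ 2 / a * pair_term a c j' (x / c)
  end.

Fixpoint sect (a c : R) (k : nat) (x : R) : R :=
  match k with
  | O => pair_term a c 0 x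
  | S k' => sect a c k' x + pair_term a c (S k') x
  end.

(** The definition adds the next pair at the top of the sum; shifting the other
    pairs by the functional equation of [g] leaves the lowest pair to be added. *)
Lemma sect_S a c k x :
  sect a c (S k) x = 1 - x + x ^ 2 / a * sect a c k (x / c).
Proof.
  induction k as [|k IH]; [reflexivity|].
  change (sect a c (S (S k)) x)
    with (sect a c (S k) x + x ^ 2 / a * pair_term a c (S k) (x / c)).
  rewrite IH. change (sect a c (S k) (x / c))
    with (sect a c k (x / c) + pair_term a c (S k) (x / c)).
  ring.
Qed.

(** The factor in front is the term of top degree of the pair, so this is the
    pair as seen after reversal of the coefficients. *)
Lemma pair_term_lead a c k x : a <> 0 -> c <> 0 -> x <> 0 ->
  pair_term a c k x = - (x ^ (2 * k + 1) / (a ^ k * c ^ (k * k))) * (1 - c ^ k / x).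
Proof.
  intros Ha Hc; revert x; induction k as [|k IH]; intros x Hx.
  - simpl. field. exact Hx.
  - simpl pair_term. rewrite IH by (apply Rmult_integral_contrapositive_currified;
      [|apply Rinv_neq_0_compat]; assumption).
    replace (2 * S k + 1)%nat with (2 + (2 * k + 1))%nat by lia.
    replace (S k * S k)%nat with ((2 * k + 1) + k * k)%nat by lia.
    replace ((x / c) ^ (2 * k + 1)) with (x ^ (2 * k + 1) / c ^ (2 * k + 1))
      by (unfold Rdiv; rewrite Rpow_mult_distr, pow_inv; reflexivity).
    replace (c ^ S k / x) with (c ^ k / (x / c)) by (simpl; field; auto).
    rewrite (pow_add x 2), (pow_add c (2 * k + 1)). simpl (a ^ S k). simpl (c ^ S k).
    field. repeat split; try apply pow_nonzero; assumption.
Qed.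

(** Read from the top, the second quotients are [b, a, b, a, ...], and the ratio
    of the last two coefficients replaces that of the first two as the unit of
    scale.  Hence the section is, up to its leading term, the section with [a] and
    [b] exchanged, at [c^k / x].  By induction on [k]: adding a pair at the top of
    one section is adding a pair at the bottom of the other. *)
Lemma sect_reversal a b k x : a <> 0 -> b <> 0 -> x <> 0 ->
  sect a (a * b) k x =
  - (x ^ (2 * k + 1) / (a ^ k * (a * b) ^ (k * k))) * sect b (a * b) k ((a * b) ^ k / x).
Proof.
  intros Ha Hb Hx.
  assert (Hc : a * b <> 0) by (apply Rmult_integral_contrapositive_currified; assumption).
  induction k as [|k IH].
  - simpl. field. exact Hx.
  - rewrite (sect_S b). cbn [sect]. rewrite IH, pair_term_lead by assumption.
    replace ((a * b) ^ S k / x / (a * b)) with ((a * b) ^ k / x)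
      by (simpl ((a * b) ^ S k); field; auto).
    set (c := a * b) in *.
    replace (2 * S k + 1)%nat with (2 + (2 * k + 1))%nat by lia.
    replace (S k * S k)%nat with ((k + k + 1) + k * k)%nat by lia.
    rewrite (pow_add x 2), (pow_add c (k + k + 1)), (pow_add c (k + k)), (pow_add c k k).
    simpl (a ^ S k). simpl (c ^ S k). rewrite pow_1.
    assert (Hck : c ^ k <> 0) by (apply pow_nonzero; exact Hc).
    assert (Hckk : c ^ (k * k) <> 0) by (apply pow_nonzero; exact Hc).
    assert (Hak : a ^ k <> 0) by (apply pow_nonzero; exact Ha).
    clear IH. revert Hckk Hck Hak.
    generalize (c ^ (k * k)) (c ^ k) (a ^ k) (x ^ (2 * k + 1)).
    intros D C A X HD HC HA.
    unfold c. field. repeat split; assumption.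
Qed.

Section Unit.
Variables (a c : R) (a_gt1 : 1 < a) (c_gt1 : 1 < c).

Lemma div_unit x : 0 <= x <= 1 -> 0 <= x / c <= 1.
Proof using c_gt1.
  intros Hx. split; [apply Rdiv_le_0_compat; lra|].
  apply Rle_trans with (x / 1); [|lra]. apply Rmult_le_compat_l; [lra|].
  apply Rinv_le_contravar; lra.
Qed.

Lemma sect_unit k x : 0 <= x <= 1 -> 0 <= sect a c k x <= 1.
Proof using a_gt1 c_gt1.
  revert x; induction k as [|k IH]; intros x Hx; [simpl; lra|].
  rewrite sect_S. destruct (IH _ (div_unit x Hx)) as [H0 H1].
  assert (Hq : 0 <= x ^ 2 / a <= x).
  { split; [apply Rdiv_le_0_compat; nra|]. apply Rle_div_l; nra. }
  split; nra.
Qed.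
End Unit.

(** The terms of degree 1 already compare strictly in the right direction, since
    [u / b < u / a], and in degree 2 and above everything carries an extra factor
    [u / (a * b)].  Two steps of
    the recursion reduce [sect_compare] to this case. *)
Lemma sect_compare_small a b k u : 1 < a -> a < b -> 0 <= u <= 1 ->
  sect b (a * b) k (u / a) <= sect a (a * b) k (u / b).
Proof.
  intros Ha Hab. assert (Hc : 1 < a * b) by nra.
  revert u; induction k as [|k IH]; intros u Hu.
  - simpl. assert (/ b < / a) by (apply Rinv_lt_contravar; nra). unfold Rdiv. nra.
  - rewrite !sect_S.
    replace (u / a / (a * b)) with (u / (a * b) / a) by (field; lra).
    replace (u / b / (a * b)) with (u / (a * b) / b) by (field; lra).
    assert (Huc := div_unit (a * b) Hc u Hu). specialize (IH _ Huc).
    assert (Hu' : 0 <= u / (a * b) / a <= 1) by (apply div_unit; lra).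
    destruct (sect_unit b (a * b) ltac:(lra) Hc k _ Hu') as [P0 P1].
    revert IH P0 P1. generalize (sect b (a * b) k (u / (a * b) / a)).
    generalize (sect a (a * b) k (u / (a * b) / b)). intros Q P H P0 P1.
    apply Rminus_le_0.
    (* [P] and [Q] are the values of the two shifted sections; write [P / a - Q / b]
       as [P * (1 / a - 1 / b) + (P - Q) / b]. *)
    replace (_ - _) with ((u * (b - a) * (1 - u / (a * b) * P)
                           + u ^ 2 * (Q - P) / b) / (a * b)) by (field; lra).
    apply Rdiv_le_0_compat; [|lra].
    assert (0 <= u ^ 2 * (Q - P) / b) by (apply Rdiv_le_0_compat; nra).
    assert (0 <= u * (b - a)) by nra.
    assert (0 <= 1 - u / (a * b) * P) by nra.
    nra.
Qed.

(** The arguments are scaled so that the quadratic parts become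
    [1 - a s (1 - s)] and [1 - b s (1 - s)]; the
    gap [(b - a) s (1 - s)] vanishes at [s = 1], where the cubic terms, with
    coefficients [- a / b] and [- b / a], take over.  Keeping whole sections instead
    of truncating makes every error a multiple of [b - a]. *)
Lemma sect_compare a b k s : 1 < a -> a < b -> 0 <= s <= 1 ->
  sect b (a * b) k (b * s) <= sect a (a * b) k (a * s).
Proof.
  intros Ha Hab Hs. assert (Hc : 1 < a * b) by nra.
  destruct k as [|k]; [simpl; nra|].
  rewrite !sect_S.
  replace (b * s / (a * b)) with (s / a) by (field; lra).
  replace (a * s / (a * b)) with (s / b) by (field; lra).
  enough (H : b * sect b (a * b) k (s / a) - a * sect a (a * b) k (s / b) <= b - a).
  { apply Rminus_le_0.
    replace (_ - _) with (s * (b - a) - s ^ 2 *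
      (b * sect b (a * b) k (s / a) - a * sect a (a * b) k (s / b))) by (field; lra).
    assert (s ^ 2 <= s) by nra. nra. }
  destruct k as [|k].
  - simpl. apply Rminus_le_0.
    replace (_ - _) with (s * (b - a) * (b + a) / (a * b)) by (field; lra).
    apply Rdiv_le_0_compat; [|lra].
    repeat apply Rmult_le_pos; lra.
  - rewrite !sect_S.
    replace (s / a / (a * b)) with (s / (a * b) / a) by (field; lra).
    replace (s / b / (a * b)) with (s / (a * b) / b) by (field; lra).
    assert (Hsc := div_unit (a * b) Hc s Hs).
    assert (IH := sect_compare_small a b k _ Ha Hab Hsc).
    assert (Hu' : 0 <= s / (a * b) / a <= 1) by (apply div_unit; lra).
    destruct (sect_unit b (a * b) ltac:(lra) Hc k _ Hu') as [P0 P1].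
    revert IH P0 P1. generalize (sect b (a * b) k (s / (a * b) / a)).
    generalize (sect a (a * b) k (s / (a * b) / b)). intros Q P H P0 P1.
    apply Rminus_le_0.
    replace (_ - _) with (s * ((b - a) * (b + a) * (1 - s / (a * b) * P)
        + a / b * s * (Q - P)) / (a * b)) by (field; lra).
    apply Rdiv_le_0_compat; [|lra].
    assert (0 <= a / b * s) by (apply Rmult_le_pos; [apply Rdiv_le_0_compat|]; lra).
    assert (0 <= a / b * s * (Q - P)) by nra.
    assert (0 <= (b - a) * (b + a)) by nra.
    assert (0 <= 1 - s / (a * b) * P) by nra.
    apply Rmult_le_pos; [lra|]. nra.
Qed.

Lemma pair_term_nonneg a c j x : 0 < a -> 1 < c -> 0 <= x <= c ^ j ->
  0 <= pair_term a c j x.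
Proof.
  intros Ha Hc; revert x; induction j as [|j IH]; intros x Hx.
  - simpl in *; lra.
  - simpl. apply Rmult_le_pos; [apply Rdiv_le_0_compat; nra|].
    apply IH. simpl in Hx. split; [apply Rdiv_le_0_compat; lra|].
    apply Rle_div_l; lra.
Qed.

Lemma pair_term_pos a c j x : 0 < a -> 1 < c -> 0 < x < c ^ j ->
  0 < pair_term a c j x.
Proof.
  intros Ha Hc; revert x; induction j as [|j IH]; intros x Hx.
  - simpl in *; lra.
  - simpl. apply Rmult_lt_0_compat; [apply Rdiv_lt_0_compat; nra|].
    apply IH. simpl in Hx. split; [apply Rdiv_lt_0_compat; lra|].
    apply Rlt_div_l; lra.
Qed.

(** One step of the recursion maps the value at [x] to the value at [c * x], and
    the added [1 - c * x] is negative too. *)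
Lemma sect_neg_geometric a c x0 : 0 < a -> 1 < c -> 1 < x0 ->
  (forall k, sect a c k x0 < 0) ->
  forall i k, (i <= k)%nat -> sect a c k (c ^ i * x0) < 0.
Proof.
  intros Ha Hc H1 H. induction i as [|i IH]; intros k Hk.
  - simpl. rewrite Rmult_1_l. apply H.
  - destruct k as [|k]; [lia|]. rewrite sect_S.
    replace (c ^ S i * x0 / c) with (c ^ i * x0) by (simpl; field; lra).
    specialize (IH k ltac:(lia)).
    assert (1 <= c ^ S i) by (apply pow_R1_Rle; lra).
    assert (0 < (c ^ S i * x0) ^ 2 / a).
    { apply Rdiv_lt_0_compat; [apply pow_lt; nra|lra]. }
    nra.
Qed.

(** By [sect_reversal] this is negativity of the section with [a] and [b]
    exchanged at the points [c^(k-i) * (b * x0 / a)], which follows from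
    [sect_neg_geometric] once it is known at [b * x0 / a]; there [sect_compare]
    bounds it by the value at [x0]. *)
Lemma sect_pos_geometric a b x0 : 1 < a -> a < b -> 1 < x0 <= a ->
  (forall k, sect a (a * b) k x0 < 0) ->
  forall i k, (i <= k)%nat -> 0 < sect a (a * b) k ((a * b) ^ i * (a / (b * x0))).
Proof.
  intros Ha Hab Hx H i k Hik. assert (Hc : 1 < a * b) by nra.
  assert (Hci : 0 < (a * b) ^ i) by (apply pow_lt; lra).
  assert (Hbx : 0 < b * x0) by nra.
  assert (Hpos : 0 < (a * b) ^ i * (a / (b * x0))).
  { apply Rmult_lt_0_compat; [lra|]. apply Rdiv_lt_0_compat; lra. }
  rewrite sect_reversal by lra.
  assert (Hneg : sect b (a * b) k
      ((a * b) ^ k / ((a * b) ^ i * (a / (b * x0)))) < 0).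
  { replace k with ((k - i) + i)%nat at 2 by lia. rewrite pow_add.
    replace (_ / _) with ((a * b) ^ (k - i) * (b * (x0 / a)))
      by (field; repeat split; lra).
    apply sect_neg_geometric; [lra|lra| |intros m|lia].
    - apply Rlt_le_trans with (b / a).
      + apply Rlt_div_r; lra.
      + replace (b * (x0 / a)) with (b / a * x0) by (field; lra).
        assert (0 < b / a) by (apply Rdiv_lt_0_compat; lra). nra.
    - eapply Rle_lt_trans; [apply sect_compare; try lra|].
      + split; [apply Rdiv_le_0_compat; lra|]. apply Rle_div_l; lra.
      + replace (a * (x0 / a)) with x0 by (field; lra). apply H. }
  assert (0 < ((a * b) ^ i * (a / (b * x0))) ^ (2 * k + 1)
     / (a ^ k * (a * b) ^ (k * k))).
  { apply Rdiv_lt_0_compat; [apply pow_lt; lra|].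
    apply Rmult_lt_0_compat; apply pow_lt; lra. }
  nra.
Qed.

(** * Monotone families of roots *)

(** A root of [q n] is a point where [q (S n)] is nonnegative, so the intermediate
    value theorem finds a root of [q (S n)] to its right.  The roots chosen in this
    way increase and stay below [r]. *)
Lemma monotone_root_sequence_falling (q : nat -> R -> R) l r :
  (forall n, continuity (q n)) -> l < r ->
  (forall n x, l <= x <= r -> q n x <= q (S n) x) ->
  (forall n, 0 < q n l) -> (forall n, q n r < 0) ->
  exists u : nat -> R,
    (forall n, l < u n < r /\ q n (u n) = 0) /\ ex_finite_lim_seq u.
Proof.
  intros Hcont Hlr Hmon Hl Hr.
  assert (Hroot : forall n y, l <= y <= r -> 0 <= q n y ->
            {x | y <= x <= r /\ q n x = 0}).
  { intros n y Hy Hq. apply (IVT_cor (q n) y r (Hcont n)); [lra|].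
    specialize (Hr n). nra. }
  set (T := fun n => {x | l <= x <= r /\ q n x = 0}).
  assert (s0 : T O).
  { destruct (Hroot O l) as [x Hx]; [lra|left; apply Hl|]. exists x. exact Hx. }
  assert (step : forall n (s : T n), {s' : T (S n) | proj1_sig s <= proj1_sig s'}).
  { intros n [y [Hy Hq]]. destruct (Hroot (S n) y Hy) as [x [Hx Hqx]].
    { rewrite <- Hq. apply Hmon, Hy. }
    assert (Hx' : l <= x <= r /\ q (S n) x = 0) by (split; [lra|exact Hqx]).
    exists (exist _ x Hx'). simpl. lra. }
  set (s := nat_rect T s0 (fun n sn => proj1_sig (step n sn))).
  exists (fun n => proj1_sig (s n)). split.
  - intros n. destruct (s n) as [x [Hx Hqx]]. simpl. split; [|exact Hqx].
    assert (x <> l) by (intros ->; specialize (Hl n); lra).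
    assert (x <> r) by (intros ->; specialize (Hr n); lra). lra.
  - apply ex_finite_lim_seq_incr with r.
    + intros n. simpl. exact (proj2_sig (step n (s n))).
    + intros n. exact (proj2 (proj1 (proj2_sig (s n)))).
Qed.

Lemma monotone_root_sequence_rising (q : nat -> R -> R) l r :
  (forall n, continuity (q n)) -> l < r ->
  (forall n x, l <= x <= r -> q n x <= q (S n) x) ->
  (forall n, q n l < 0) -> (forall n, 0 < q n r) ->
  exists u : nat -> R,
    (forall n, l < u n < r /\ q n (u n) = 0) /\ ex_finite_lim_seq u.
Proof.
  intros Hcont Hlr Hmon Hl Hr.
  destruct (monotone_root_sequence_falling (fun n x => q n (l + r - x)) l r)
    as [u [Hu [L HL]]].
  - intros n. apply (continuity_comp (fun x => l + r - x)); [|apply Hcont].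
    apply derivable_continuous. intros x. reg.
  - exact Hlr.
  - intros n x Hx. apply Hmon. lra.
  - intros n. replace (l + r - l) with r by ring. apply Hr.
  - intros n. replace (l + r - r) with l by ring. apply Hl.
  - exists (fun n => l + r - u n). split.
    + intros n. destruct (Hu n) as [H1 H2]. split; [lra|exact H2].
    + exists (l + r - L). apply is_lim_seq_minus'; [apply is_lim_seq_const|exact HL].
Qed.

Lemma pair_term_continuous a c j : continuity (pair_term a c j).
Proof.
  induction j as [|j IH]; intros x; simpl; [reg|].
  apply continuity_pt_mult; [unfold Rdiv; reg|].
  apply (continuity_pt_comp (fun y => y / c)); [unfold Rdiv; reg|apply IH].
Qed.

Lemma sect_continuous a c k : continuity (sect a c k).
Proof.
  induction k as [|k IH]; [apply (pair_term_continuous a c 0)|].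
  apply continuity_plus; [exact IH|apply (pair_term_continuous a c (S k))].
Qed.

(** * One root between consecutive sign changes *)

(** The points [w, x0, c * w, c * x0, c^2 * w, ...], at which the sections
    take alternating signs. *)
Definition endpoint (c w x0 : R) (i : nat) : R :=
  c ^ (i / 2) * (if Nat.even i then w else x0).

Lemma endpoint_even c w x0 i : endpoint c w x0 (2 * i) = c ^ i * w.
Proof.
  unfold endpoint. rewrite Nat.even_even, Nat.mul_comm, Nat.div_mul by lia.
  reflexivity.
Qed.

Lemma endpoint_odd c w x0 i : endpoint c w x0 (2 * i + 1) = c ^ i * x0.
Proof.
  unfold endpoint. rewrite Nat.even_odd.
  replace ((2 * i + 1) / 2)%nat with i; [reflexivity|].
  apply Nat.div_unique with 1%nat; lia.
Qed.

Lemma parity_cases (P : nat -> Prop) :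
  (forall j, P (2 * j)%nat) -> (forall j, P (2 * j + 1)%nat) -> forall i, P i.
Proof.
  intros He Ho i. destruct (Nat.Even_or_Odd i) as [[j ->]|[j ->]]; auto.
Qed.

Section Roots.
Variables (a b x0 : R).
Hypotheses (a_gt1 : 1 < a) (a_lt_b : a < b) (x0_range : 1 < x0 <= a)
  (x0_neg : forall k, sect a (a * b) k x0 < 0).

Let w := a / (b * x0).
Let c := a * b.
Let e := endpoint c w x0.

(** The weak inequality [x0 <= c * w = a^2 / x0] is [x0 <= a]; equality is excluded
    because the sections have opposite signs at the two points. *)
Lemma endpoint_lt i : 0 < e i < e (S i).
Proof using a_gt1 a_lt_b x0_range x0_neg.
  assert (Hbx : 0 < b * x0) by nra.
  assert (Hw : 0 < w) by (apply Rdiv_lt_0_compat; lra).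
  assert (Hw1 : w < x0) by (apply Rlt_div_l; nra).
  assert (Hcw : c * w = a ^ 2 / x0) by (unfold c, w; field; lra).
  assert (Hle : x0 <= c * w).
  { rewrite Hcw. apply Rle_div_r; nra. }
  assert (Hlt : x0 < c * w).
  { destruct Hle as [H|H]; [exact H|exfalso].
    assert (Hp := sect_pos_geometric a b x0 a_gt1 a_lt_b x0_range x0_neg 1 1 (le_n _)).
    rewrite pow_1 in Hp. fold w c in Hp. rewrite <- H in Hp.
    specialize (x0_neg 1). unfold c in Hp. lra. }
  assert (Hc : 0 < c) by (unfold c; nra).
  unfold e. pattern i. apply parity_cases; clear i; intros j.
  - replace (S (2 * j)) with (2 * j + 1)%nat by lia.
    rewrite endpoint_even, endpoint_odd.
    assert (0 < c ^ j) by (apply pow_lt, Hc). split; nra.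
  - replace (S (2 * j + 1)) with (2 * S j)%nat by lia.
    rewrite endpoint_even, endpoint_odd.
    assert (0 < c ^ j) by (apply pow_lt, Hc). simpl. split; nra.
Qed.

Lemma endpoint_mono i j : (i <= j)%nat -> e i <= e j.
Proof using a_gt1 a_lt_b x0_range x0_neg.
  induction 1 as [|j _ IH]; [lra|]. assert (H := endpoint_lt j). lra.
Qed.

Lemma sect_le_S k x : 0 <= x <= e (2 * k + 1) ->
  sect a c k x <= sect a c (S k) x.
Proof using a_gt1 a_lt_b x0_range.
  intros Hx. cbn [sect].
  assert (0 <= pair_term a c (S k) x).
  2: lra.
  assert (1 < c) by (unfold c; nra).
  apply pair_term_nonneg; [lra|assumption|].
  unfold e in Hx. rewrite endpoint_odd in Hx. split; [lra|].
  simpl. assert (0 < c ^ k) by (apply pow_lt; lra).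
  assert (x0 <= c) by (unfold c; nra). nra.
Qed.

Lemma sect_endpoint_even j k : (j <= k)%nat -> 0 < sect a c k (e (2 * j)).
Proof using a_gt1 a_lt_b x0_range x0_neg.
  intros H. unfold e. rewrite endpoint_even. apply sect_pos_geometric; assumption.
Qed.

Lemma sect_endpoint_odd j k : (j <= k)%nat -> sect a c k (e (2 * j + 1)) < 0.
Proof using a_gt1 a_lt_b x0_range x0_neg.
  intros H. unfold e. rewrite endpoint_odd.
  apply sect_neg_geometric; try assumption; unfold c; try nra.
Qed.

(** [v i k] is a root of section number [k] in the [i]-th interval as soon as
    [i <= 2 * k], and an arbitrary point of that interval before.  Up to [c^k * x0]
    the sections increase with [k], so the roots in even intervals move to
    the right and those in odd intervals to the left. *)
Lemma sect_root_limits : exists (v : nat -> nat -> R) (y : nat -> R), forall i,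
  (forall k, e i < v i k < e (S i)) /\
  (forall k, (i <= 2 * k)%nat -> sect a c k (v i k) = 0) /\
  is_lim_seq (v i) (y i) /\ e i <= y i.
Proof using a_gt1 a_lt_b x0_range x0_neg.
  (* Roots and limit are produced together for each [i], then chosen for all [i]. *)
  assert (H : forall i, exists p : (nat -> R) * R,
     (forall k, e i < fst p k < e (S i)) /\
     (forall k, (i <= 2 * k)%nat -> sect a c k (fst p k) = 0) /\
     is_lim_seq (fst p) (snd p) /\ e i <= snd p).
  (* [k0] is the least index of a section that has a root in the [i]-th interval. *)
  { intros i. set (k0 := ((i + 1) / 2)%nat).
    assert (Hk0 : (i <= 2 * k0)%nat).
    { unfold k0. assert (H := Nat.div_mod_eq (i + 1) 2).
      assert (H' := Nat.mod_upper_bound (i + 1) 2). lia. }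
    assert (Hk0' : forall k, (i <= 2 * k)%nat -> (k0 <= k)%nat).
    { intros k Hk. unfold k0.
      assert (H := Nat.div_mod_eq (i + 1) 2). lia. }
    assert (Hu : exists u : nat -> R,
      (forall n, e i < u n < e (S i) /\ sect a c (k0 + n) (u n) = 0)
      /\ ex_finite_lim_seq u).
    { assert (Hcont : forall n, continuity (sect a c (k0 + n)))
        by (intros n; apply sect_continuous).
      assert (Hlt := endpoint_lt i).
      assert (Hmon : forall n x, e i <= x <= e (S i) ->
                sect a c (k0 + n) x <= sect a c (k0 + S n) x).
      { intros n x Hx. rewrite Nat.add_succ_r. apply sect_le_S. split; [lra|].
        apply Rle_trans with (e (S i)); [lra|]. apply endpoint_mono. lia. }
      destruct (Nat.Even_or_Odd i) as [[j Hj]|[j Hj]].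
      - apply (monotone_root_sequence_falling (fun n => sect a c (k0 + n))); try assumption; [lra| |]; intros n.
        + rewrite Hj. apply sect_endpoint_even. lia.
        + replace (S i) with (2 * j + 1)%nat by lia. apply sect_endpoint_odd. lia.
      - apply (monotone_root_sequence_rising (fun n => sect a c (k0 + n))); try assumption; [lra| |]; intros n.
        + rewrite Hj. apply sect_endpoint_odd. lia.
        + replace (S i) with (2 * S j)%nat by lia. apply sect_endpoint_even. lia. }
    destruct Hu as [u [Hu [L HL]]].
    exists (fun k => u (k - k0)%nat, L). simpl. repeat split.
    - apply Hu.
    - apply Hu.
    - intros k Hk. specialize (Hu (k - k0)%nat).
      replace (k0 + (k - k0))%nat with k in Hu by (specialize (Hk0' k Hk); lia).
      apply Hu.
    - apply (is_lim_seq_incr_n _ k0). apply is_lim_seq_ext with (2 := HL).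
      intros n. f_equal. lia.
    - apply (is_lim_seq_le (fun _ => e i) u (e i) L); [|apply is_lim_seq_const|exact HL].
      intros n. destruct (Hu n) as [H _]. lra. }
  exists (fun i => fst (proj1_sig (constructive_indefinite_description _ (H i)))),
         (fun i => snd (proj1_sig (constructive_indefinite_description _ (H i)))).
  intros i. exact (proj2_sig (constructive_indefinite_description _ (H i))).
Qed.

End Roots.

(** * Polynomials with prescribed zeros *)

(** Polynomial functions of degree at most [n], in Horner form, which lets a root
    be split off by induction on the degree. *)
Fixpoint poly_le (n : nat) (P : C -> C) : Prop :=
  match n with
  | O => exists k : C, forall z, P z = k
  | S n' => exists (k : C) (Q : C -> C), poly_le n' Q /\ forall z, P z = (k + z * Q z)%C
  end.

Lemma poly_le_scal n l P : poly_le n P -> poly_le n (fun z => l * P z)%C.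
Proof.
  revert P; induction n as [|n IH]; intros P.
  - intros [k Hk]. exists (l * k)%C. intros z. rewrite Hk. reflexivity.
  - intros [k [P' [HP Hk]]]. exists (l * k)%C, (fun z => l * P' z)%C.
    split; [apply IH, HP|]. intros z. rewrite Hk. ring.
Qed.

Lemma poly_le_comp_scal n l P : poly_le n P -> poly_le n (fun z => P (l * z))%C.
Proof.
  revert P; induction n as [|n IH]; intros P.
  - intros [k Hk]. exists k. intros z. apply Hk.
  - intros [k [P' [HP Hk]]]. exists k, (fun z => l * P' (l * z))%C.
    split; [apply (poly_le_scal n l (fun z => P' (l * z)%C)), IH, HP|].
    intros z. rewrite Hk. ring.
Qed.

Lemma poly_le_ext n P Q : (forall z, P z = Q z) -> poly_le n P -> poly_le n Q.
Proof.
  intros E. destruct n as [|n].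
  - intros [k Hk]. exists k. intros z. rewrite <- E. apply Hk.
  - intros [k [R [HR Hk]]]. exists k, R. split; [exact HR|].
    intros z. rewrite <- E. apply Hk.
Qed.

Lemma poly_le_divided_difference n P r : poly_le (S n) P ->
  exists Q, poly_le n Q /\ forall z, (P z - P r = (z - r) * Q z)%C.
Proof.
  revert P; induction n as [|n IH]; intros P [k [R [HR HP]]].
  - exists R. split; [exact HR|]. destruct HR as [l Hl]. intros z.
    rewrite !HP, !Hl. ring.
  - destruct (IH R HR) as [Q [HQ HRQ]].
    exists (fun z => R r + z * Q z)%C. split; [exists (R r), Q; split; auto|].
    intros z. rewrite !HP.
    replace (R z) with (R r + (R z - R r))%C by ring. rewrite HRQ. ring.
Qed.

Lemma zeros_prod_S x m z :
  zeros_prod x (S m) z = (zeros_prod x m z * (RtoC 1 + z / RtoC (x m)))%C.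
Proof.
  unfold zeros_prod. rewrite seq_S, map_app, fold_right_app. simpl.
  generalize (map (fun k => (RtoC 1 + z / RtoC (x k))%C) (seq 0 m)).
  induction l as [|t l IH]; simpl; [|rewrite IH]; ring.
Qed.

Lemma RtoC_neq x y : x <> y -> RtoC x <> RtoC y.
Proof. intros H E. apply H. injection E. auto. Qed.

(** Split off the last root: the cofactor, rescaled to the value 1 at 0, still
    vanishes at the other roots, since they differ from the last one. *)
Lemma poly_factorization n P (x : nat -> R) : poly_le n P -> P (RtoC 0) = RtoC 1 ->
  (forall i, (i < n)%nat -> x i <> 0 /\ P (RtoC (- x i)) = RtoC 0) ->
  (forall i j, (i < j < n)%nat -> x i <> x j) ->
  forall z, P z = zeros_prod x n z.
Proof.
  revert P; induction n as [|n IH]; intros P HP H0 Hx Hinj z.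
  - destruct HP as [k Hk]. rewrite Hk in H0. rewrite Hk, H0. reflexivity.
  - destruct (poly_le_divided_difference n P (RtoC (- x n)) HP) as [Q [HQ HPQ]].
    destruct (Hx n) as [Hn HPn]; [lia|].
    assert (HnC : RtoC (x n) <> RtoC 0) by (apply RtoC_neq, Hn).
    assert (Hfac : forall t, P t = ((t + RtoC (x n)) * Q t)%C).
    { intros t. specialize (HPQ t). rewrite HPn, RtoC_opp in HPQ.
      replace (t + RtoC (x n))%C with (t - - RtoC (x n))%C by ring.
      rewrite <- HPQ. ring. }
    rewrite zeros_prod_S, <- (IH (fun t => RtoC (x n) * Q t)%C).
    + rewrite Hfac. field. exact HnC.
    + apply poly_le_scal, HQ.
    + rewrite <- H0, Hfac. ring.
    + intros i Hi. destruct (Hx i) as [Hi0 HPi]; [lia|]. split; [exact Hi0|].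
      rewrite Hfac in HPi.
      assert (Hd : (RtoC (- x i) + RtoC (x n))%C <> RtoC 0).
      { rewrite <- RtoC_plus. apply RtoC_neq. specialize (Hinj i n).
        intros E. apply Hinj; [lia|lra]. }
      assert (HQ0 : Q (RtoC (- x i)) = RtoC 0).
      { replace (Q (RtoC (- x i))) with
          (/ (RtoC (- x i) + RtoC (x n))
             * ((RtoC (- x i) + RtoC (x n)) * Q (RtoC (- x i))))%C
          by (field; exact Hd).
        rewrite HPi. ring. }
      rewrite HQ0. ring.
    + intros i j Hij. apply Hinj. lia.
Qed.

(** * Limits of complex sequences *)

(** Convergence in modulus: estimates become inequalities between real
    sequences. *)
Definition Clim (u : nat -> C) (l : C) : Prop :=
  is_lim_seq (fun n => Cmod (u n - l)) 0.

Lemma Clim_filterlim u l : Clim u l -> filterlim u eventually (locally l).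
Proof.
  intros H. apply (filterlim_locally (U := C_UniformSpace)). intros eps.
  apply is_lim_seq_spec in H. destruct (H eps) as [N HN].
  exists N. intros n Hn. apply C_NormedModule_mixin_compat1.
  specialize (HN n Hn). rewrite Rminus_0_r, Rabs_pos_eq in HN by apply Cmod_ge_0.
  exact HN.
Qed.

Lemma filterlim_Clim u l :
  filterlim u eventually (locally (T := C_UniformSpace) l) -> Clim u l.
Proof.
  intros H. apply is_lim_seq_spec. intros eps.
  apply (filterlim_locally_ball_norm (K := C_AbsRing) (U := C_NormedModule)) with (eps := eps) in H.
  destruct H as [N HN]. exists N. intros n Hn.
  rewrite Rminus_0_r, Rabs_pos_eq by apply Cmod_ge_0. exact (HN n Hn).
Qed.

Lemma Clim_mult u v k l : Clim u k -> Clim v l ->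
  Clim (fun n => u n * v n)%C (k * l)%C.
Proof.
  intros Hu Hv.
  apply (is_lim_seq_le_le (fun _ => 0) _
    (fun n => (Cmod (u n - k) * Cmod (v n - l) + Cmod (u n - k) * Cmod l)
              + Cmod k * Cmod (v n - l))).
  - intros n. split; [apply Cmod_ge_0|]. rewrite <- !Cmod_mult.
    eapply Rle_trans; [|apply Rplus_le_compat_r, Cmod_triangle].
    eapply Rle_trans; [|apply Cmod_triangle]. right. f_equal. ring.
  - apply is_lim_seq_const.
  - replace 0 with (0 * 0 + 0 * Cmod l + Cmod k * 0) by ring.
    repeat apply is_lim_seq_plus'; apply is_lim_seq_mult';
      try apply is_lim_seq_const; assumption.
Qed.

Lemma Clim_const_mult k u l : Clim u l -> Clim (fun n => k * u n)%C (k * l)%C.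
Proof.
  intros H. apply (Clim_mult (fun _ => k)); [|exact H].
  apply is_lim_seq_ext with (2 := is_lim_seq_const 0).
  intros _. replace (k - k)%C with (RtoC 0) by ring. symmetry. apply Cmod_0.
Qed.

Lemma Clim_Re (u : nat -> R) l : Clim (fun n => RtoC (u n)) l -> is_lim_seq u (Re l).
Proof.
  intros H. replace (Finite (Re l)) with (Finite (0 + Re l)) by (f_equal; ring).
  apply is_lim_seq_ext with (fun n => (u n - Re l) + Re l); [intros n; ring|].
  apply is_lim_seq_plus'; [|apply is_lim_seq_const].
  apply is_lim_seq_abs_0.
  apply (is_lim_seq_le_le (fun _ => 0) _ (fun n => Cmod (RtoC (u n) - l)));
    [|apply is_lim_seq_const|exact H].
  intros n. split; [apply Rabs_pos|].
  exact (re_le_Cmod (RtoC (u n) - l)%C).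
Qed.

Lemma Clim_unique_of_eventually u l k :
  Clim u l -> eventually (fun n => u n = k) -> l = k.
Proof.
  intros H [N HN].
  assert (L : is_lim_seq (fun n => Cmod (u n - l)) (Cmod (k - l))).
  { apply is_lim_seq_ext_loc with (fun _ => Cmod (k - l)); [|apply is_lim_seq_const].
    exists N. intros n Hn. rewrite (HN n Hn). reflexivity. }
  assert (E := is_lim_seq_unique _ _ L). rewrite (is_lim_seq_unique _ _ H) in E.
  injection E as E. symmetry in E. apply Cmod_eq_0 in E.
  replace l with (k - (k - l))%C by ring. rewrite E. ring.
Qed.

(** * Limits of products with moving zeros *)

Lemma zeros_prod_rescale lam x m z : lam <> 0 -> (forall k, x k <> 0) ->
  zeros_prod (fun k => x k / lam) m z = zeros_prod x m (RtoC lam * z)%C.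
Proof.
  intros Hl Hx. induction m as [|m IH]; [reflexivity|].
  rewrite !zeros_prod_S, IH. f_equal. f_equal. rewrite RtoC_div by exact Hl.
  field. split; apply RtoC_neq; auto.
Qed.

Lemma zeros_prod_lim (v : nat -> nat -> R) y m z :
  (forall i k, 0 < v i k) -> (forall i, 0 < y i) ->
  (forall i, is_lim_seq (v i) (y i)) ->
  Clim (fun k => zeros_prod (fun i => v i k) m z) (zeros_prod y m z).
Proof.
  intros Hv Hy Hlim. induction m as [|m IH].
  - unfold Clim. apply is_lim_seq_ext with (2 := is_lim_seq_const 0).
    intros n. replace (_ - _)%C with (RtoC 0) by (cbv [zeros_prod map seq fold_right]; ring).
    symmetry. apply Cmod_0.
  - rewrite zeros_prod_S.
    apply is_lim_seq_ext with (fun k => Cmod (zeros_prod (fun i => v i k) m z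
       * (RtoC 1 + z / RtoC (v m k)) - zeros_prod y m z * (RtoC 1 + z / RtoC (y m)))).
    { intros k. rewrite zeros_prod_S. reflexivity. }
    apply (Clim_mult (fun k => zeros_prod (fun i => v i k) m z)
             (fun k => RtoC 1 + z / RtoC (v m k))%C _ _ IH).
    apply is_lim_seq_ext with (fun k => Cmod z * Rabs (/ v m k - / y m)).
    { intros k. unfold Cdiv. assert (Hvk := Hv m k). assert (Hym := Hy m).
      rewrite <- !RtoC_inv by lra. rewrite <- Cmod_R, <- Cmod_mult. f_equal.
      rewrite RtoC_minus. ring. }
    replace 0 with (Cmod z * Rabs (/ y m - / y m)) by (rewrite Rminus_diag, Rabs_R0; ring).
    apply is_lim_seq_mult'; [apply is_lim_seq_const|].
    apply (is_lim_seq_abs _ (Finite (/ y m - / y m))). apply is_lim_seq_minus'; [|apply is_lim_seq_const].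
    apply (is_lim_seq_inv (v m) (y m)); [apply Hlim|].
    intros E. injection E. specialize (Hy m). lra.
Qed.

Lemma exp_le x y : x <= y -> exp x <= exp y.
Proof.
  intros [H|H]; [left; apply exp_increasing, H|right; rewrite H; reflexivity].
Qed.

(** [s] is the sequence of partial sums of a convergent majorant of the
    reciprocals of the zeros. *)
Section Majorant.
Variables (s : nat -> R) (z : C).
Hypothesis (s0 : s O = 0).
Let K := Cmod z.

Lemma Cmod_factor_le (x : R) d : 0 < x -> / x <= d ->
  Cmod (RtoC 1 + z / RtoC x) <= exp (K * d) /\ Cmod (z / RtoC x) <= exp (K * d) - 1.
Proof using.
  intros Hx Hd.
  assert (HK : 0 <= K) by apply Cmod_ge_0.
  assert (H : Cmod (z / RtoC x) <= K * d).
  { rewrite Cmod_div by (apply RtoC_neq; lra). rewrite Cmod_R, Rabs_pos_eq by lra.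
    apply Rmult_le_compat_l; assumption. }
  assert (H2 := exp_ineq1_le (K * d)). split; [|lra].
  eapply Rle_trans; [apply Cmod_triangle|]. rewrite Cmod_1. lra.
Qed.

Lemma zeros_prod_bound x m :
  (forall i, (i < m)%nat -> 0 < x i /\ / x i <= s (S i) - s i) ->
  Cmod (zeros_prod x m z) <= exp (K * s m).
Proof using s0.
  induction m as [|m IH]; intros Hx.
  - rewrite s0, Rmult_0_r, exp_0. cbv [zeros_prod map seq fold_right]. rewrite Cmod_1. lra.
  - rewrite zeros_prod_S, Cmod_mult.
    destruct (Hx m) as [H1 H2]; [lia|].
    replace (K * s (S m)) with (K * s m + K * (s (S m) - s m)) by ring.
    rewrite exp_plus. apply Rmult_le_compat; try apply Cmod_ge_0.
    + apply IH. intros i Hi. apply Hx. lia.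
    + apply Cmod_factor_le; assumption.
Qed.

(** The difference of two partial products is bounded by the difference of the
    exponentials that bound them; this telescopes because
    [exp (K * s m) * (exp (K * d) - 1)] is the increment of [exp (K * s m)] when [s]
    grows by [d]. *)
Lemma zeros_prod_tail x m n :
  (forall i, (i < m + n)%nat -> 0 < x i /\ / x i <= s (S i) - s i) ->
  Cmod (zeros_prod x (m + n) z - zeros_prod x m z) <= exp (K * s (m + n)%nat) - exp (K * s m).
Proof using s0.
  induction n as [|n IH]; intros Hx.
  - rewrite Nat.add_0_r. replace (_ - _)%C with (RtoC 0) by ring. rewrite Cmod_0. lra.
  - rewrite Nat.add_succ_r, zeros_prod_S.
    destruct (Hx (m + n)%nat) as [H1 H2]; [lia|].
    replace (_ - _)%C with ((zeros_prod x (m + n) z - zeros_prod x m z)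
      + zeros_prod x (m + n) z * (z / RtoC (x (m + n)%nat)))%C by ring.
    eapply Rle_trans; [apply Cmod_triangle|]. rewrite Cmod_mult.
    assert (IH' := IH ltac:(intros i Hi; apply Hx; lia)).
    assert (HB := zeros_prod_bound x (m + n) ltac:(intros i Hi; apply Hx; lia)).
    assert (HF := proj2 (Cmod_factor_le _ _ H1 H2)).
    replace (K * s (S (m + n))) with (K * s (m + n)%nat + K * (s (S (m + n)) - s (m + n)%nat)) by ring.
    rewrite exp_plus.
    assert (HM := Rmult_le_compat _ _ _ _ (Cmod_ge_0 _) (Cmod_ge_0 _) HB HF). lra.
Qed.

(** Tannery's theorem for products: for fixed [m] the first [m] factors converge,
    and [zeros_prod_tail] bounds the effect of the remaining ones uniformly
    in [k]. *)
Lemma zeros_prod_tannery (v : nat -> nat -> R) (y : nat -> R) (S_inf : R) (N : nat -> nat) (L : C) :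
  (forall i k, 0 < v i k) -> (forall i, 0 < y i) ->
  (forall i k, / v i k <= s (S i) - s i) ->
  (forall i, is_lim_seq (v i) (y i)) ->
  is_lim_seq s S_inf -> (forall m, s m <= S_inf) ->
  (forall k, (k <= N k)%nat) ->
  Clim (fun k => zeros_prod (fun i => v i k) (N k) z) L ->
  Clim (fun m => zeros_prod y m z) L.
Proof using s0.
  intros Hv Hy Hvs Hlim Hs Hsle HN HL.
  assert (HK : 0 <= K) by apply Cmod_ge_0.
  (* Pass through the section number [k] and let [k] tend to infinity. *)
  assert (Hbound : forall m, Cmod (zeros_prod y m z - L) <= exp (K * S_inf) - exp (K * s m)).
  { intros m.
    assert (Hfin := zeros_prod_lim v y m z Hv Hy Hlim).
    apply (is_lim_seq_le_loc (fun _ => Cmod (zeros_prod y m z - L))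
      (fun k => Cmod (zeros_prod (fun i => v i k) (N k) z - L)
        + Cmod (zeros_prod (fun i => v i k) m z - zeros_prod y m z)
        + (exp (K * S_inf) - exp (K * s m)))
      (Cmod (zeros_prod y m z - L)) (exp (K * S_inf) - exp (K * s m))).
    - exists m. intros k Hk.
      replace (N k) with (m + (N k - m))%nat by (specialize (HN k); lia).
      assert (HT := zeros_prod_tail (fun i => v i k) m (N k - m)
                ltac:(intros i _; split; [apply Hv|apply Hvs])).
      set (A := zeros_prod (fun i => v i k) (m + (N k - m)) z) in *.
      set (B := zeros_prod (fun i => v i k) m z) in *.
      assert (HE : exp (K * s (m + (N k - m))%nat) <= exp (K * S_inf)).
      { apply exp_le, Rmult_le_compat_l; auto. }
      replace (zeros_prod y m z - L)%C with ((A - L) + - (B - zeros_prod y m z) + - (A - B))%C by ring.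
      eapply Rle_trans; [apply Cmod_triangle|]. rewrite Cmod_opp.
      apply Rplus_le_compat; [|lra].
      eapply Rle_trans; [apply Cmod_triangle|]. rewrite Cmod_opp. lra.
    - apply is_lim_seq_const.
    - replace (Finite (exp (K * S_inf) - exp (K * s m)))
        with (Finite (0 + 0 + (exp (K * S_inf) - exp (K * s m)))) by (f_equal; ring).
      apply is_lim_seq_plus'; [|apply is_lim_seq_const].
      apply is_lim_seq_plus'; [exact HL|exact Hfin]. }
  apply (is_lim_seq_le_le (fun _ => 0) _ (fun m => exp (K * S_inf) - exp (K * s m))).
  - intros m. split; [apply Cmod_ge_0|apply Hbound].
  - apply is_lim_seq_const.
  - replace 0 with (exp (K * S_inf) - exp (K * S_inf)) by ring.
    apply is_lim_seq_minus'; [apply is_lim_seq_const|].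
    apply (is_lim_seq_continuous exp).
    + apply derivable_continuous_pt, derivable_pt_exp.
    + apply is_lim_seq_mult'; [apply is_lim_seq_const|exact Hs].
Qed.
End Majorant.

(** * Complex sections *)

Fixpoint Cpair_term (a c : R) (j : nat) (z : C) : C :=
  match j with
  | O => RtoC 1 - z
  | S j' => RtoC (/ a) * z ^ 2 * Cpair_term a c j' (RtoC (/ c) * z)
  end.

Fixpoint Csect (a c : R) (k : nat) (z : C) : C :=
  match k with
  | O => Cpair_term a c 0 z
  | S k' => Csect a c k' z + Cpair_term a c (S k') z
  end.

Lemma Csect_S a c k z :
  (Csect a c (S k) z
   = RtoC 1 - z + RtoC (/ a) * z ^ 2 * Csect a c k (RtoC (/ c) * z))%C.
Proof.
  induction k as [|k IH]; [reflexivity|].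
  change (Csect a c (S (S k)) z)
    with (Csect a c (S k) z
          + RtoC (/ a) * z ^ 2 * Cpair_term a c (S k) (RtoC (/ c) * z))%C.
  rewrite IH. change (Csect a c (S k) (RtoC (/ c) * z))
    with (Csect a c k (RtoC (/ c) * z) + Cpair_term a c (S k) (RtoC (/ c) * z))%C.
  ring.
Qed.

Lemma Csect_RtoC a c k x : Csect a c k (RtoC x) = RtoC (sect a c k x).
Proof.
  revert x; induction k as [|k IH]; intros x.
  - simpl. rewrite RtoC_minus. reflexivity.
  - rewrite Csect_S, sect_S, <- RtoC_mult, IH, <- RtoC_pow, <- !RtoC_mult,
      <- RtoC_minus, <- RtoC_plus.
    unfold Rdiv. rewrite (Rmult_comm (/ c)), (Rmult_comm (/ a)). reflexivity.
Qed.

Lemma Csect_poly a c k : poly_le (2 * k + 1) (Csect a c k).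
Proof.
  induction k as [|k IH].
  - exists (RtoC 1), (fun _ => - RtoC 1)%C. split; [exists (- RtoC 1)%C; reflexivity|].
    intros z. simpl. ring.
  - replace (2 * S k + 1)%nat with (S (S (2 * k + 1))) by lia.
    exists (RtoC 1),
      (fun z => - RtoC 1 + z * (RtoC (/ a) * Csect a c k (RtoC (/ c) * z)))%C.
    split.
    + exists (- RtoC 1)%C, (fun z => RtoC (/ a) * Csect a c k (RtoC (/ c) * z))%C.
      split; [|reflexivity]. apply poly_le_scal.
      exact (poly_le_comp_scal (2 * k + 1) (RtoC (/ c)) _ IH).
    + intros z. rewrite Csect_S. simpl. ring.
Qed.

Lemma entire_partial_sums coef f z : entire_with_coeffs coef f ->
  Clim (sum_n (G := C_AbelianMonoid) (fun n => RtoC (coef n) * z ^ n)%C) (f z).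
Proof.
  intros H. specialize (H z). apply filterlim_Clim.
  unfold is_pseries, is_series in H.
  eapply filterlim_ext; [|exact H].
  intros n. apply sum_n_ext. intros k.
  change (pow_n z k * RtoC (coef k) = RtoC (coef k) * z ^ k)%C.
  replace (pow_n z k) with (z ^ k)%C; [ring|].
  induction k as [|k IH]; [reflexivity|].
  change (z * z ^ k = z * pow_n z k)%C. rewrite IH. reflexivity.
Qed.

(** * From the Taylor coefficients to the sections *)

Section Coefficients.
Variables (coef : nat -> R) (a b : R).
Hypotheses (coef_pos : forall k, 0 < coef k) (a_gt1 : 1 < a) (a_lt_b : a < b)
  (q_even : forall j : nat, (1 <= j)%nat -> second_quotient coef (2 * j) = a)
  (q_odd : forall j : nat, (1 <= j)%nat -> second_quotient coef (2 * j + 1) = b).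

Let lam := coef 1%nat / coef 0%nat.
Let c := a * b.

Lemma second_quotient_eq n q : second_quotient coef (S (S n)) = q ->
  coef (S n) ^ 2 = q * (coef n * coef (S (S n))).
Proof using coef_pos.
  unfold second_quotient.
  replace (S (S n) - 1)%nat with (S n) by lia.
  replace (S (S n) - 2)%nat with n by lia.
  intros <-. field. assert (H := coef_pos n). assert (H' := coef_pos (S (S n))). lra.
Qed.

(** The product of two consecutive second quotients is always [a * b]. *)
Lemma coef_two_step n :
  coef (S n) * coef (S (S n)) = c * (coef n * coef (S (S (S n)))).
Proof using coef_pos q_even q_odd.
  assert (H : exists q q', q * q' = c /\ second_quotient coef (S (S n)) = q
            /\ second_quotient coef (S (S (S n))) = q').
  { destruct (Nat.Even_or_Odd n) as [[j ->]|[j ->]].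
    - exists a, b. split; [reflexivity|]. split.
      + replace (S (S (2 * j))) with (2 * (S j))%nat by lia. apply q_even. lia.
      + replace (S (S (S (2 * j)))) with (2 * S j + 1)%nat by lia. apply q_odd. lia.
    - exists b, a. split; [unfold c; ring|]. split.
      + replace (S (S (2 * j + 1))) with (2 * (S j) + 1)%nat by lia. apply q_odd. lia.
      + replace (S (S (S (2 * j + 1)))) with (2 * S (S j))%nat by lia.
        apply q_even. lia. }
  destruct H as [q [q' [Hq [H1 H2]]]].
  apply second_quotient_eq in H1, H2. rewrite <- Hq.
  assert (P1 := coef_pos (S n)). assert (P2 := coef_pos (S (S n))).
  apply Rmult_eq_reg_l with (coef (S n) * coef (S (S n))).
  - transitivity (coef (S n) ^ 2 * coef (S (S n)) ^ 2); [ring|].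
    rewrite H1, H2. ring.
  - apply Rmult_integral_contrapositive_currified; lra.
Qed.

Lemma coef_shift n : coef (S (S n)) = lam ^ 2 / a * (coef n / c ^ n).
Proof using coef_pos q_even q_odd a_gt1 a_lt_b.
  assert (P := coef_pos). assert (Hc : 0 < c) by (unfold c; nra).
  induction n as [|n IH].
  - assert (H := second_quotient_eq 0 a (q_even 1 (le_n _))).
    assert (P0 := P 0%nat). unfold lam. simpl.
    replace (coef 1%nat / coef 0%nat * (coef 1%nat / coef 0%nat * 1))
      with (coef 1%nat ^ 2 / coef 0%nat ^ 2) by (field; lra).
    rewrite H. field. lra.
  - assert (H := coef_two_step n).
    assert (Pn := P n). assert (PS := P (S n)).
    apply Rmult_eq_reg_l with (c * coef n); [|nra].
    transitivity (c * (coef n * coef (S (S (S n))))); [ring|].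
    rewrite <- H, IH. simpl (c ^ S n). field.
    repeat split; try lra. apply pow_nonzero. lra.
Qed.

Lemma coef_term_shift n z :
  (RtoC (coef (S (S n))) * z ^ S (S n)
   = RtoC (/ a) * (RtoC lam * z) ^ 2 * (RtoC (coef n) * (RtoC (/ c) * z) ^ n))%C.
Proof using coef_pos q_even q_odd a_gt1 a_lt_b.
  rewrite coef_shift, !Cpow_mult_l, <- !RtoC_pow.
  replace (lam ^ 2 / a * (coef n / c ^ n))
    with (/ a * lam ^ 2 * (coef n * (/ c) ^ n)) by (rewrite pow_inv; unfold Rdiv; ring).
  rewrite !RtoC_mult. simpl (z ^ S (S n))%C. simpl (z ^ 2)%C. ring.
Qed.

Lemma coef_pair j z :
  (RtoC (coef (2 * j)) * z ^ (2 * j) + RtoC (coef (S (2 * j))) * z ^ S (2 * j)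
   = RtoC (coef 0) * Cpair_term a c j (- (RtoC lam * z)))%C.
Proof using coef_pos q_even q_odd a_gt1 a_lt_b.
  revert z; induction j as [|j IH]; intros z.
  - simpl. assert (P0 := coef_pos 0).
    replace (coef 1%nat) with (coef 0%nat * lam) by (unfold lam; field; lra).
    rewrite RtoC_mult. ring.
  - replace (2 * S j)%nat with (S (S (2 * j))) by lia.
    rewrite !coef_term_shift, <- Cmult_plus_distr_l, IH. simpl Cpair_term.
    replace (RtoC (/ c) * - (RtoC lam * z))%C with (- (RtoC lam * (RtoC (/ c) * z)))%C by ring.
    simpl Cpow. ring.
Qed.

Lemma partial_sum_sect k z :
  (sum_n (G := C_AbelianMonoid) (fun n => RtoC (coef n) * z ^ n) (2 * k + 1)
   = RtoC (coef 0) * Csect a c k (- (RtoC lam * z)))%C.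
Proof using coef_pos q_even q_odd a_gt1 a_lt_b.
  induction k as [|k IH].
  - change (2 * 0 + 1)%nat with 1%nat. rewrite sum_Sn, sum_O. exact (coef_pair 0 z).
  - replace (2 * S k + 1)%nat with (S (S (2 * k + 1))) by lia.
    rewrite !sum_Sn, IH, <- plus_assoc. simpl Csect.
    rewrite Cmult_plus_distr_l.
    assert (H := coef_pair (S k) z).
    replace (2 * S k)%nat with (S (2 * k + 1)) in H by lia.
    simpl Cpair_term in H. rewrite <- H. reflexivity.
Qed.

Lemma sect_lim f z : entire_with_coeffs coef f ->
  Clim (fun k => Csect a c k (- (RtoC lam * z)))%C (RtoC (/ coef 0) * f z)%C.
Proof using coef_pos q_even q_odd a_gt1 a_lt_b.
  intros Hf. assert (P0 := coef_pos 0).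
  assert (H := Clim_const_mult (RtoC (/ coef 0)) _ _ (entire_partial_sums coef f z Hf)).
  apply (is_lim_seq_subseq _ _ (fun k => (2 * k + 1)%nat)) in H;
    [|apply eventually_subseq; intros k; lia].
  eapply is_lim_seq_ext; [|exact H]. intros k. cbv beta.
  rewrite partial_sum_sect, Cmult_assoc, <- RtoC_mult, Rinv_l, Cmult_1_l by lra.
  reflexivity.
Qed.

(** On [[0, a]] every pair beyond the first is nonnegative, so the sections
    increase to their limit, which is nonpositive at the given point.  The section
    of degree 1 being negative there gives the bound [x0 > 1]. *)
Lemma sect_neg_of_value f z0 y : entire_with_coeffs coef f ->
  - (coef 1%nat / coef 2%nat) <= z0 <= 0 -> f (RtoC z0) = RtoC y -> y <= 0 ->
  1 < - (lam * z0) <= a /\ forall k, sect a c k (- (lam * z0)) < 0.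
Proof using coef_pos q_even q_odd a_gt1 a_lt_b.
  intros Hf Hz Hy Hy0. set (x := - (lam * z0)).
  assert (P0 := coef_pos 0). assert (P1 := coef_pos 1). assert (P2 := coef_pos 2).
  assert (Hlam : 0 < lam) by (apply Rdiv_lt_0_compat; lra).
  assert (Hc : a < c) by (unfold c; nra).
  assert (Ha : lam * (coef 1%nat / coef 2%nat) = a).
  { assert (H := second_quotient_eq 0 a (q_even 1 (le_n _))). unfold lam.
    transitivity (coef 1%nat ^ 2 / (coef 0%nat * coef 2%nat)); [field; lra|].
    rewrite H. field. lra. }
  assert (Hx : 0 <= x <= a) by (unfold x; split; nra).
  assert (Hlim : is_lim_seq (fun k => sect a c k x) (/ coef 0%nat * y)).
  { assert (H := sect_lim f (RtoC z0) Hf). rewrite Hy, <- !RtoC_mult, <- RtoC_opp in H.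
    apply (Clim_Re (fun k => sect a c k x) (RtoC (/ coef 0%nat * y))). eapply is_lim_seq_ext; [|exact H].
    intros k. cbv beta. rewrite <- Csect_RtoC. reflexivity. }
  assert (Hck : forall k, c <= c ^ S k).
  { intros k. simpl. assert (1 <= c ^ k) by (apply pow_R1_Rle; lra). nra. }
  assert (Hle : forall k, sect a c k x <= 0).
  { intros k. apply Rle_trans with (/ coef 0%nat * y).
    - apply (is_lim_seq_incr_compare (fun k => sect a c k x)); [exact Hlim|].
      intros n. simpl sect.
      assert (H := pair_term_nonneg a c (S n) x ltac:(lra) ltac:(lra)
                ltac:(specialize (Hck n); lra)). simpl in H. lra.
    - assert (0 < / coef 0%nat) by (apply Rinv_0_lt_compat; lra). nra. }
  assert (Hx1 : 1 <= x) by (specialize (Hle 0%nat); simpl in Hle; lra).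
  assert (Hneg : forall k, sect a c k x < 0).
  { intros k. specialize (Hle (S k)).
    assert (H := pair_term_pos a c (S k) x ltac:(lra) ltac:(lra)
              ltac:(specialize (Hck k); lra)).
    cbn [sect] in Hle. lra. }
  split; [|exact Hneg]. specialize (Hneg 0%nat). simpl in Hneg. lra.
Qed.

End Coefficients.

(** * The product expansion *)

(** Every second step multiplies the endpoints by [d^2], so up to a constant they
    grow at least like [d^i]; this makes the reciprocals of the roots summable. *)
Lemma endpoint_lower d w x0 i : 1 < d -> 0 < w < x0 ->
  w / d * d ^ i <= endpoint (d ^ 2) w x0 i.
Proof.
  intros Hd Hw. pattern i. apply parity_cases; clear i; intros j.
  - rewrite endpoint_even, <- pow_mult.
    assert (0 < d ^ (2 * j)) by (apply pow_lt; lra).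
    assert (w / d <= w) by (apply Rle_div_l; nra). nra.
  - rewrite endpoint_odd, <- pow_mult, pow_add, pow_1.
    assert (0 < d ^ (2 * j)) by (apply pow_lt; lra).
    replace (w / d * (d ^ (2 * j) * d)) with (w * d ^ (2 * j)) by (field; lra). nra.
Qed.

Lemma sect_factorization a c k (v : nat -> R) z :
  (forall i, 0 < v i < v (S i)) ->
  (forall i, (i <= 2 * k)%nat -> sect a c k (v i) = 0) ->
  Csect a c k (- z)%C = zeros_prod v (2 * k + 1) z.
Proof.
  intros Hv Hroot.
  apply (poly_factorization _ (fun t => Csect a c k (- t))%C).
  - assert (H := poly_le_comp_scal _ (- RtoC 1)%C _ (Csect_poly a c k)).
    revert H. apply poly_le_ext. intros t. f_equal. ring.
  - replace (- RtoC 0)%C with (RtoC 0) by ring. rewrite Csect_RtoC. f_equal.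
    destruct k as [|k]; [simpl; ring|]. rewrite sect_S. unfold Rdiv. ring.
  - intros i Hi. split; [specialize (Hv i); lra|].
    rewrite <- RtoC_opp, Ropp_involutive, Csect_RtoC, Hroot by lia. reflexivity.
  - assert (Hlt : forall i j, (i < j)%nat -> v i < v j).
    { intros i j Hij. induction Hij as [|j _ IH]; [apply Hv|].
      specialize (Hv j). lra. }
    intros i j [Hij _] E. specialize (Hlt i j Hij). lra.
Qed.

(** The sections are the products over their roots by [sect_factorization]; let
    their number go to infinity under the geometric majorant of
    [endpoint_lower]. *)
Lemma LP_of_nonpos_value coef f a b z0 y :
  (forall k, 0 < coef k) -> entire_with_coeffs coef f -> 1 < a -> a < b ->
  (forall j : nat, (1 <= j)%nat -> second_quotient coef (2 * j) = a) ->
  (forall j : nat, (1 <= j)%nat -> second_quotient coef (2 * j + 1) = b) ->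
  - (coef 1%nat / coef 2%nat) <= z0 <= 0 -> f (RtoC z0) = RtoC y -> y <= 0 ->
  LaguerrePolya_I f.
Proof.
  intros Hpos Hf Ha Hab Hqe Hqo Hz Hy Hy0.
  destruct (sect_neg_of_value coef a b Hpos Ha Hab Hqe Hqo f z0 y Hf Hz Hy Hy0)
    as [Hx Hneg].
  assert (Hlim := fun z => sect_lim coef a b Hpos Ha Hab Hqe Hqo f z Hf).
  assert (P0 := Hpos 0%nat). assert (P1 := Hpos 1%nat).
  set (lam := coef 1%nat / coef 0%nat) in *. set (x0 := - (lam * z0)) in *.
  assert (Hlam : 0 < lam) by (apply Rdiv_lt_0_compat; lra).
  assert (He := endpoint_lt a b x0 Ha Hab Hx Hneg).
  destruct (sect_root_limits a b x0 Ha Hab Hx Hneg) as [v [yl Hv]].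
  set (w := a / (b * x0)) in *.
  (* The endpoints are multiplied by [a * b] every second step, hence by [d] per step
     on average. *)
  set (d := sqrt (a * b)).
  assert (Hd2 : a * b = d ^ 2) by (unfold d; simpl; rewrite Rmult_1_r, sqrt_sqrt; nra).
  assert (Hd : 1 < d) by (assert (0 <= d) by apply sqrt_pos; nra).
  assert (Hw : 0 < w < x0).
  { specialize (He 0%nat). unfold endpoint in He. simpl in He. lra. }
  set (M := fun i => d / w * (/ d) ^ i).
  assert (HM : forall i x, endpoint (a * b) w x0 i <= x -> / x <= M i).
  { intros i x Hix. assert (H := endpoint_lower d w x0 i Hd Hw).
    rewrite <- Hd2 in H.
    assert (Hdi : 0 < d ^ i) by (apply pow_lt; lra).
    replace (M i) with (/ (w / d * d ^ i))
      by (unfold M; rewrite pow_inv; field; repeat split; lra).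
    apply Rinv_le_contravar; [|lra].
    apply Rmult_lt_0_compat; [apply Rdiv_lt_0_compat|]; lra. }
  assert (Hid : 0 < / d < 1).
  { split; [apply Rinv_0_lt_compat; lra|]. rewrite <- Rinv_1.
    apply Rinv_lt_contravar; lra. }
  assert (Hyl : forall i, 0 < yl i).
  { intros i. destruct (Hv i) as [_ [_ [_ H]]]. specialize (He i). lra. }
  split; [exists coef; exact Hf|].
  exists (coef 0%nat), 0%nat, 0, (fun i => yl i / lam).
  split; [lra|]. split.
  { intros k. apply Rdiv_lt_0_compat; auto. }
  right. split.
  - apply (ex_series_le (V := R_CompleteNormedModule) _ (fun i => (lam * (d / w)) * (/ d) ^ i)).
    + intros i. change (norm (/ (yl i / lam))) with (Rabs (/ (yl i / lam))).
      assert (Hi := Hyl i).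
      replace (/ (yl i / lam)) with (lam * / yl i) by (field; lra).
      assert (0 < / yl i) by (apply Rinv_0_lt_compat, Hi).
      rewrite Rabs_pos_eq by nra. rewrite Rmult_assoc.
      apply Rmult_le_compat_l; [lra|]. apply HM. apply Hv.
    + apply (ex_series_scal (V := R_NormedModule) (lam * (d / w)) (fun n => (/ d) ^ n)).
      apply ex_series_geom. rewrite Rabs_pos_eq; lra.
  - intros z. exists (RtoC (/ coef 0%nat) * f z)%C. split.
    + apply Clim_filterlim.
      apply is_lim_seq_ext with
        (fun m => Cmod (zeros_prod yl m (RtoC lam * z) - RtoC (/ coef 0%nat) * f z)).
      { intros m. rewrite zeros_prod_rescale; [reflexivity|lra|].
        intros k. specialize (Hyl k). lra. }
      set (s := fun m => d / w / (1 - / d) * (1 - (/ d) ^ m)).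
      assert (HA : 0 < d / w / (1 - / d)).
      { apply Rdiv_lt_0_compat; [apply Rdiv_lt_0_compat|]; lra. }
      assert (Hs : forall i, s (S i) - s i = M i).
      { intros i. unfold s, M. simpl. field. repeat split; lra. }
      apply (zeros_prod_tannery s (RtoC lam * z)%C ltac:(unfold s; simpl; ring)
               v yl (d / w / (1 - / d)) (fun k => (2 * k + 1)%nat)).
      * intros i k. destruct (Hv i) as [H _]. specialize (H k). specialize (He i). lra.
      * exact Hyl.
      * intros i k. rewrite Hs. apply HM. destruct (Hv i) as [H _].
        specialize (H k). lra.
      * intros i. apply Hv.
      * replace (Finite (d / w / (1 - / d)))
          with (Finite (d / w / (1 - / d) * (1 - 0))) by (f_equal; ring).
        apply is_lim_seq_mult'; [apply is_lim_seq_const|].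
        apply is_lim_seq_minus'; [apply is_lim_seq_const|].
        apply is_lim_seq_geom. rewrite Rabs_pos_eq; lra.
      * intros m. unfold s. assert (0 < (/ d) ^ m) by (apply pow_lt; lra). nra.
      * intros k. lia.
      * eapply is_lim_seq_ext; [|exact (Hlim z)]. intros k. cbv beta. f_equal. f_equal.
        apply sect_factorization.
        -- intros i. destruct (Hv i) as [H _]. destruct (Hv (S i)) as [H' _].
           specialize (H k). specialize (H' k). specialize (He i). lra.
        -- intros i Hi. apply Hv, Hi.
    + replace (Cexp (RtoC 0 * z)) with (RtoC 1).
      * replace (RtoC (coef 0%nat) * z ^ 0 * 1 * (RtoC (/ coef 0%nat) * f z))%C
          with (RtoC (coef 0%nat) * RtoC (/ coef 0%nat) * f z)%C by (simpl; ring).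
        rewrite <- RtoC_mult, Rinv_r, Cmult_1_l by lra. reflexivity.
      * replace (RtoC 0 * z)%C with (RtoC 0) by ring. unfold Cexp, RtoC. simpl.
        rewrite exp_0, cos_0, sin_0. f_equal; ring.
Qed.

(** * Cubic Taylor bounds *)

(** For nonnegative coefficients the remainder of order 4 at [t] in [[0, 1]] is at
    most [t^4] times its value at 1, hence at most [t^4 * phi 1]. *)
Lemma power_series_cubic_bounds (d : nat -> R) (phi : R -> R) :
  (forall n, 0 <= d n) ->
  (forall t, 0 <= t <= 1 -> is_lim_seq (sum_n (fun n => d n * t ^ n)) (phi t)) ->
  forall t, 0 <= t <= 1 ->
  let cubic := d 0%nat + d 1%nat * t + d 2%nat * t ^ 2 + d 3%nat * t ^ 3 in
  cubic <= phi t <= cubic + t ^ 4 * phi 1.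
Proof.
  intros Hd Hlim t Ht cubic.
  assert (Hone : forall N, sum_n (fun n => d n * 1 ^ n) N <= phi 1).
  { apply (is_lim_seq_incr_compare (sum_n (fun n => d n * 1 ^ n))); [apply Hlim; lra|].
    intros n. rewrite sum_Sn, pow1. change plus with Rplus. specialize (Hd (S n)). lra. }
  assert (Hge : forall N, cubic <= sum_n (fun n => d n * t ^ n) (3 + N) <=
            cubic + t ^ 4 * sum_n (fun n => d n * 1 ^ n) (3 + N)).
  { assert (0 <= t ^ 4) by (apply pow_le; lra).
    induction N as [|N IH].
    - simpl Nat.add. rewrite !sum_Sn, !sum_O. change plus with Rplus. unfold cubic.
      rewrite !pow1. assert (H0 := Hd 0%nat). assert (H1 := Hd 1%nat).
      assert (H2 := Hd 2%nat). assert (H3 := Hd 3%nat). simpl. split; [lra|].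
      enough (0 <= t ^ 4 * (d 0%nat + d 1%nat + d 2%nat + d 3%nat)) by (simpl in *; lra).
      apply Rmult_le_pos; lra.
    - rewrite Nat.add_succ_r, !sum_Sn, pow1. change plus with Rplus.
      assert (Hn := Hd (S (3 + N))).
      assert (Hp : 0 <= t ^ S (3 + N) <= t ^ 4).
      { split; [apply pow_le; lra|]. replace (S (3 + N)) with (4 + N)%nat by lia.
        rewrite pow_add. assert (0 <= t ^ N <= 1).
        { split; [apply pow_le; lra|]. rewrite <- (pow1 N). apply pow_incr. lra. }
        nra. }
      split; nra. }
  assert (Hlim' := proj1 (is_lim_seq_incr_n _ 3 _) (Hlim t Ht)).
  split.
  - apply (is_lim_seq_le (fun _ => cubic) _ cubic (phi t)) with (3 := Hlim').
    + intros n. rewrite Nat.add_comm. apply Hge.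
    + apply is_lim_seq_const.
  - apply (is_lim_seq_le _ (fun _ => cubic + t ^ 4 * phi 1) (phi t) (cubic + t ^ 4 * phi 1)) with (2 := Hlim').
    + intros n. rewrite Nat.add_comm. eapply Rle_trans; [apply Hge|].
      apply Rplus_le_compat_l, Rmult_le_compat_l; [apply pow_le; lra|apply Hone].
    + apply is_lim_seq_const.
Qed.

Lemma exp_cubic_bounds beta t : 0 <= beta -> 0 <= t <= 1 ->
  let cubic := 1 + beta * t + beta ^ 2 / 2 * t ^ 2 + beta ^ 3 / 6 * t ^ 3 in
  cubic <= exp (beta * t) <= cubic + t ^ 4 * exp beta.
Proof.
  intros Hb Ht.
  assert (H := power_series_cubic_bounds (fun n => beta ^ n / INR (Factorial.fact n))
                 (fun t => exp (beta * t))).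
  simpl INR in H.
  replace (1 + beta * t + beta ^ 2 / 2 * t ^ 2 + beta ^ 3 / 6 * t ^ 3)
    with (beta ^ 0 / 1 + beta ^ 1 / 1 * t + beta ^ 2 / (1 + 1) * t ^ 2
          + beta ^ 3 / (1 + 1 + 1 + 1 + 1 + 1) * t ^ 3) by (simpl; field).
  replace (exp beta) with (exp (beta * 1)) by (f_equal; ring).
  apply H; [| |exact Ht].
  - intros n. apply Rdiv_le_0_compat; [apply pow_le, Hb|].
    apply INR_fact_lt_0.
  - intros s _. assert (He := is_exp_Reals (beta * s)).
    apply (is_lim_seq_ext (sum_n (fun n => scal (pow_n (beta * s) n) (/ INR (Factorial.fact n))))).
    + intros n. apply sum_n_ext. intros k. rewrite pow_n_pow, Rpow_mult_distr.
      change (beta ^ k * s ^ k * / INR (Factorial.fact k)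
              = beta ^ k / INR (Factorial.fact k) * s ^ k). unfold Rdiv. ring.
    + exact He.
Qed.

(** The inequality fails for nonzero [d] at [t = |d| / (|d| + M + 1)]. *)
Lemma zero_of_linear_bound d M : (forall t, 0 < t <= 1 -> Rabs d <= M * t) -> d = 0.
Proof.
  intros H. destruct (Req_dec d 0) as [E|E]; [exact E|exfalso].
  assert (Hd := Rabs_pos_lt d E).
  assert (H1 := H 1 ltac:(lra)).
  assert (Ht : 0 < Rabs d / (Rabs d + M + 1) <= 1).
  { split; [apply Rdiv_lt_0_compat; lra|]. apply Rle_div_l; lra. }
  specialize (H _ Ht).
  assert (M * (Rabs d / (Rabs d + M + 1)) < Rabs d); [|lra].
  replace (M * (Rabs d / (Rabs d + M + 1))) with (M * Rabs d / (Rabs d + M + 1))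
    by (field; lra).
  apply Rlt_div_l; nra.
Qed.

Lemma cubic_coefficients_zero d1 d2 d3 K :
  (forall t, 0 < t <= 1 ->
     Rabs (d1 * t + d2 * t ^ 2 + d3 * t ^ 3) <= K * t ^ 4) ->
  d1 = 0 /\ d2 = 0 /\ d3 = 0.
Proof.
  intros H.
  assert (Hdiv : forall j r t, 0 < t -> Rabs (t ^ j * r) <= K * t ^ 4 -> (j <= 3)%nat ->
            Rabs r <= K * t ^ (4 - j)).
  { intros j r t Ht Hr Hj. assert (Htj : 0 < t ^ j) by (apply pow_lt, Ht).
    rewrite Rabs_mult, (Rabs_pos_eq (t ^ j)) in Hr by lra.
    apply Rmult_le_reg_l with (t ^ j); [exact Htj|].
    replace (t ^ 4) with (t ^ j * t ^ (4 - j)) in Hr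
      by (rewrite <- pow_add; f_equal; lia). lra. }
  assert (K0 : 0 <= K).
  { specialize (H 1 ltac:(lra)). rewrite !pow1 in H. assert (P := Rabs_pos (d1 * 1 + d2 * 1 + d3 * 1)). lra. }
  assert (H1 : d1 = 0).
  { apply zero_of_linear_bound with (K + Rabs d2 + Rabs d3). intros t Ht.
    specialize (Hdiv 1%nat (d1 + d2 * t + d3 * t ^ 2) t ltac:(lra)).
    replace (t ^ 1 * (d1 + d2 * t + d3 * t ^ 2))
      with (d1 * t + d2 * t ^ 2 + d3 * t ^ 3) in Hdiv by ring.
    specialize (Hdiv (H t Ht) ltac:(lia)). simpl in Hdiv.
    assert (T1 := Rabs_triang (d1 + d2 * t + d3 * (t * (t * 1))) (- (d2 * t + d3 * (t * (t * 1))))).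
    replace (_ + - _) with d1 in T1 by ring. rewrite Rabs_Ropp in T1.
    assert (T2 := Rabs_triang (d2 * t) (d3 * (t * (t * 1)))).
    rewrite !Rabs_mult, (Rabs_pos_eq t), (Rabs_pos_eq 1) in T2 by lra.
    assert (Q2 := Rabs_pos d2). assert (Q3 := Rabs_pos d3).
    assert (t * t <= t) by nra. assert (t * t * t <= t) by nra. nra. }
  assert (H2 : d2 = 0).
  { apply zero_of_linear_bound with (K + Rabs d3). intros t Ht.
    specialize (Hdiv 2%nat (d2 + d3 * t) t ltac:(lra)).
    replace (t ^ 2 * (d2 + d3 * t))
      with (d1 * t + d2 * t ^ 2 + d3 * t ^ 3) in Hdiv by (rewrite H1; ring).
    specialize (Hdiv (H t Ht) ltac:(lia)). simpl in Hdiv.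
    assert (T1 := Rabs_triang (d2 + d3 * t) (- (d3 * t))).
    replace (_ + - _) with d2 in T1 by ring. rewrite Rabs_Ropp in T1.
    rewrite Rabs_mult, (Rabs_pos_eq t) in T1 by lra.
    assert (t * t <= t) by nra. nra. }
  split; [exact H1|]. split; [exact H2|].
  apply zero_of_linear_bound with K. intros t Ht.
  specialize (Hdiv 3%nat d3 t ltac:(lra)).
  replace (t ^ 3 * d3) with (d1 * t + d2 * t ^ 2 + d3 * t ^ 3) in Hdiv
    by (rewrite H1, H2; ring).
  specialize (Hdiv (H t Ht) ltac:(lia)). simpl in Hdiv. lra.
Qed.

Fixpoint psum (g : nat -> R) (m : nat) : R :=
  match m with O => 0 | S m' => psum g m' + g m' end.

Lemma psum_le g h m : (forall k, g k <= h k) -> psum g m <= psum h m.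
Proof.
  intros H. induction m as [|m IH]; simpl; [lra|]. specialize (H m). lra.
Qed.

Lemma psum_scal k g m : psum (fun i => k * g i) m = k * psum g m.
Proof. induction m as [|m IH]; simpl; [|rewrite IH]; ring. Qed.

Lemma psum_converges g B : (forall k, 0 <= g k) -> (forall m, psum g m <= B) ->
  exists l, is_lim_seq (psum g) (Finite l).
Proof.
  intros Hg HB. destruct (ex_finite_lim_seq_incr (psum g) B) as [l Hl].
  - intros n. simpl. specialize (Hg n). lra.
  - exact HB.
  - exists l. exact Hl.
Qed.

Lemma psum_quadratic u s m :
  psum (fun k => u k * (s - u k) ^ 2) m
  = psum u m * s ^ 2 - 2 * psum (fun k => u k ^ 2) m * s + psum (fun k => u k ^ 3) m.
Proof. induction m as [|m IH]; cbn [psum]; [|rewrite IH]; ring. Qed.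

Lemma psum_mono g m n : (forall k, 0 <= g k) -> (m <= n)%nat -> psum g m <= psum g n.
Proof.
  intros H. induction 1 as [|n _ IH]; simpl; [lra|]. specialize (H n). lra.
Qed.

Lemma psum_nonneg g m : (forall k, 0 <= g k) -> 0 <= psum g m.
Proof. intros H. induction m as [|m IH]; simpl; [lra|]. specialize (H m). lra. Qed.

(** * Power sums of the reciprocal zeros *)

Fixpoint linear_prod (u : nat -> R) (m : nat) (t : R) : R :=
  match m with O => 1 | S m' => linear_prod u m' t * (1 + t * u m') end.

(** [newton2] and [newton3] are Newton's formulas for the elementary symmetric
    functions of degree 2 and 3 in terms of power sums. *)
Definition newton2 (p1 p2 : R) := (p1 ^ 2 - p2) / 2.
Definition newton3 (p1 p2 p3 : R) := (p1 ^ 3 - 3 * p1 * p2 + 2 * p3) / 6.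
Definition newton_cubic (p1 p2 p3 t : R) :=
  1 + p1 * t + newton2 p1 p2 * t ^ 2 + newton3 p1 p2 p3 * t ^ 3.

Section Product.
Variables (beta : R) (u : nat -> R).
Hypotheses (beta_ge0 : 0 <= beta) (u_ge0 : forall k, 0 <= u k).

Let p1 m := beta + psum u m.
Let p2 m := psum (fun k => u k ^ 2) m.
Let p3 m := psum (fun k => u k ^ 3) m.

(** A further zero turns the elementary symmetric functions [e2] and [e3] into
    [e2 + u * p1] and [e3 + u * e2], which preserves nonnegativity; the exponential
    factor alone gives [beta^2 / 2] and [beta^3 / 6]. *)
Lemma newton_nonneg m : 0 <= p1 m /\ 0 <= newton2 (p1 m) (p2 m)
  /\ 0 <= newton3 (p1 m) (p2 m) (p3 m).
Proof using beta_ge0 u_ge0.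
  unfold newton2, newton3, p1, p2, p3.
  induction m as [|m [H1 [H2 H3]]]; cbn [psum].
  - assert (0 <= beta ^ 3) by (apply pow_le, beta_ge0). simpl in *. repeat split; nra.
  - specialize (u_ge0 m).
    set (q1 := beta + psum u m) in *. set (q2 := psum (fun k => u k ^ 2) m) in *.
    set (q3 := psum (fun k => u k ^ 3) m) in *.
    replace (beta + (psum u m + u m)) with (q1 + u m) by (unfold q1; ring).
    split; [lra|]. split.
    + replace (_ / _) with ((q1 ^ 2 - q2) / 2 + u m * q1) by field. nra.
    + replace (_ / _) with ((q1 ^ 3 - 3 * q1 * q2 + 2 * q3) / 6
                            + u m * ((q1 ^ 2 - q2) / 2)) by field.
      nra.
Qed.

(** The constant [exp (2 * p1)] is chosen so that the induction closes: a new
    factor [1 + t * u] multiplies the remainder by at most [1 + u] and adds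
    [u * e3 * t^4], and [e3 <= exp (2 * p1)], so that both are absorbed in
    [1 + 2 * u <= exp (2 * u)].  The bound on [e3] is the induction hypothesis at
    [t = 1]. *)
Lemma linear_prod_bounds m t : 0 <= t <= 1 ->
  0 <= exp (beta * t) * linear_prod u m t <= exp (p1 m) /\
  newton_cubic (p1 m) (p2 m) (p3 m) t <= exp (beta * t) * linear_prod u m t
    <= newton_cubic (p1 m) (p2 m) (p3 m) t + t ^ 4 * exp (2 * p1 m).
Proof using beta_ge0 u_ge0.
  revert t. induction m as [|m IH]; intros t Ht;
    assert (Ht4 : 0 <= t ^ 4) by (apply pow_le; lra).
  - unfold newton_cubic, newton2, newton3, p1, p2, p3. cbn [psum]. cbn [linear_prod].
    rewrite Rplus_0_r, Rmult_1_r.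
    assert (H := exp_cubic_bounds beta t beta_ge0 Ht). cbv zeta in H.
    assert (He := exp_pos (beta * t)).
    assert (exp (beta * t) <= exp beta) by (apply exp_le; nra).
    assert (exp beta <= exp (2 * beta)) by (apply exp_le; nra).
    replace ((beta ^ 2 - 0) / 2) with (beta ^ 2 / 2) by field.
    replace ((beta ^ 3 - 3 * beta * 0 + 2 * 0) / 6) with (beta ^ 3 / 6) by field.
    split; [lra|]. split; [lra|]. eapply Rle_trans; [apply H|].
    apply Rplus_le_compat_l, Rmult_le_compat_l; assumption.
  - destruct (newton_nonneg m) as [N1 [N2 N3]].
    assert (Hu := u_ge0 m).
    assert (E1 : p1 (S m) = p1 m + u m) by (unfold p1; simpl; ring).
    assert (Hcubic : newton_cubic (p1 (S m)) (p2 (S m)) (p3 (S m)) t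
      = (1 + t * u m) * newton_cubic (p1 m) (p2 m) (p3 m) t
        - t ^ 4 * (u m * newton3 (p1 m) (p2 m) (p3 m))).
    { rewrite E1. unfold newton_cubic, newton2, newton3, p2, p3. cbn [psum]. field. }
    assert (HN3 : newton3 (p1 m) (p2 m) (p3 m) <= exp (2 * p1 m)).
    { destruct (IH 1 ltac:(lra)) as [[_ Hb1] [Hc1 _]].
      assert (exp (p1 m) <= exp (2 * p1 m)) by (apply exp_le; lra).
      unfold newton_cubic in Hc1. lra. }
    destruct (IH t Ht) as [[IHa IHb] [IHc IHd]].
    rewrite Hcubic, E1. cbn [linear_prod]. rewrite <- Rmult_assoc.
    set (P := exp (beta * t) * linear_prod u m t) in *.
    set (Q := newton_cubic (p1 m) (p2 m) (p3 m) t) in *.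
    set (T := newton3 (p1 m) (p2 m) (p3 m)) in *.
    assert (Htu : 0 <= t * u m <= u m) by nra.
    assert (He1 := exp_ineq1_le (u m)). assert (He2 := exp_ineq1_le (2 * u m)).
    assert (Hp1 := exp_pos (p1 m)). assert (Hp2 := exp_pos (2 * p1 m)).
    replace (2 * (p1 m + u m)) with (2 * p1 m + 2 * u m) by ring.
    rewrite !exp_plus.
    split; [split; [nra|]|split].
    + apply Rmult_le_compat; lra.
    + assert (0 <= t ^ 4 * (u m * T)) by (apply Rmult_le_pos; nra). nra.
    + assert (Hs : exp (2 * p1 m) * (1 + u m) + u m * T <= exp (2 * p1 m) * exp (2 * u m)).
      { assert (u m * T <= u m * exp (2 * p1 m)) by (apply Rmult_le_compat_l; assumption).
        assert (exp (2 * p1 m) * (1 + 2 * u m) <= exp (2 * p1 m) * exp (2 * u m))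
          by (apply Rmult_le_compat_l; lra). lra. }
      apply (Rmult_le_compat_l (t ^ 4)) in Hs; [|exact Ht4].
      assert (P * (1 + t * u m) <= (Q + t ^ 4 * exp (2 * p1 m)) * (1 + t * u m))
        by (apply Rmult_le_compat_r; lra).
      assert (t ^ 4 * exp (2 * p1 m) * (t * u m) <= t ^ 4 * exp (2 * p1 m) * u m)
        by (apply Rmult_le_compat_l; [apply Rmult_le_pos|]; lra).
      lra.
Qed.

End Product.

Ltac lim_arith :=
  lazymatch goal with
  | |- is_lim_seq (fun n => @?u n + @?v n) (Finite (?k + ?l)) =>
      apply (is_lim_seq_plus' u v k l); lim_arith
  | |- is_lim_seq (fun n => @?u n - @?v n) (Finite (?k - ?l)) =>
      apply (is_lim_seq_minus' u v k l); lim_arith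
  | |- is_lim_seq (fun n => @?u n * @?v n) (Finite (?k * ?l)) =>
      apply (is_lim_seq_mult' u v k l); lim_arith
  | _ => first [assumption | apply is_lim_seq_const]
  end.

(** Near 0 the cubic Taylor polynomials of the product and of the power series
    agree to order [t^4], so their coefficients coincide; in terms of [p2] and [p3]
    these are Newton's identities.  Since [0 <= u k <= X], [p2 <= X * p1], and the
    quadratic [sum of u_k (s - u_k)^2 >= 0] in [s] gives the Cauchy-Schwarz
    inequality; the exponent [beta] can only increase [p1]. *)
Lemma product_power_sums (d : nat -> R) (phi : R -> R) beta u X B :
  0 <= beta -> (forall k, 0 <= u k <= X) -> (forall m, psum u m <= B) ->
  (forall n, 0 <= d n) -> d 0%nat = 1 -> 0 < d 1%nat ->
  (forall t, 0 <= t <= 1 -> is_lim_seq (sum_n (fun n => d n * t ^ n)) (phi t)) ->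
  (forall t, exists P : R, is_lim_seq (fun m => linear_prod u m t) P
                           /\ phi t = exp (beta * t) * P) ->
  exists p2 p3,
    d 2%nat = newton2 (d 1%nat) p2 /\ d 3%nat = newton3 (d 1%nat) p2 p3 /\
    p2 <= X * d 1%nat /\ p2 ^ 2 <= d 1%nat * p3.
Proof.
  intros Hbeta Hu HB Hd Hd0 Hd1 Hser Hprod.
  assert (Hu0 : forall k, 0 <= u k) by (intros k; apply Hu).
  assert (HX : 0 <= X) by (specialize (Hu 0%nat); lra).
  assert (Hle2 : forall m, psum (fun k => u k ^ 2) m <= X * psum u m).
  { intros m. rewrite <- psum_scal. apply psum_le. intros k. specialize (Hu k). simpl. nra. }
  assert (Hle3 : forall m, psum (fun k => u k ^ 3) m <= X ^ 2 * psum u m).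
  { intros m. rewrite <- psum_scal. apply psum_le. intros k. specialize (Hu k).
    assert (u k * u k <= X * X) by nra. simpl. nra. }
  destruct (psum_converges u B Hu0 HB) as [l1 L1].
  destruct (psum_converges (fun k => u k ^ 2) (X * B)) as [p2 L2].
  { intros k. apply pow_le, Hu0. }
  { intros m. specialize (Hle2 m). specialize (HB m). nra. }
  destruct (psum_converges (fun k => u k ^ 3) (X ^ 2 * B)) as [p3 L3].
  { intros k. apply pow_le, Hu0. }
  { intros m. specialize (Hle3 m). specialize (HB m). assert (0 <= X ^ 2) by nra. nra. }
  set (p1 := beta + l1).
  assert (LP1 : is_lim_seq (fun m => beta + psum u m) p1)
    by (apply is_lim_seq_plus'; [apply is_lim_seq_const|exact L1]).
  assert (Hcub : forall t, 0 <= t <= 1 ->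
    newton_cubic p1 p2 p3 t <= phi t <= newton_cubic p1 p2 p3 t + t ^ 4 * exp (2 * (beta + B))).
  { intros t Ht. destruct (Hprod t) as [P [HP ->]].
    assert (LP : is_lim_seq (fun m => exp (beta * t) * linear_prod u m t) (exp (beta * t) * P))
      by (apply is_lim_seq_mult'; [apply is_lim_seq_const|exact HP]).
    assert (LC : is_lim_seq (fun m => newton_cubic (beta + psum u m) (psum (fun k => u k ^ 2) m)
                  (psum (fun k => u k ^ 3) m) t) (newton_cubic p1 p2 p3 t)).
    { unfold newton_cubic, newton2, newton3, Rdiv. simpl pow.
      lim_arith. }
    split.
    - refine (is_lim_seq_le _ _ _ _ _ LC LP). intros m.
      apply (linear_prod_bounds beta u Hbeta Hu0 m t Ht).
    - refine (is_lim_seq_le _ (fun m => newton_cubic (beta + psum u m)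
         (psum (fun k => u k ^ 2) m) (psum (fun k => u k ^ 3) m) t
         + t ^ 4 * exp (2 * (beta + B))) _ (Finite (_ + _)) _ LP _).
      + intros m. eapply Rle_trans; [apply (linear_prod_bounds beta u Hbeta Hu0 m t Ht)|].
        apply Rplus_le_compat_l, Rmult_le_compat_l; [apply pow_le; lra|].
        apply exp_le. specialize (HB m). lra.
      + apply is_lim_seq_plus'; [exact LC|apply is_lim_seq_const]. }
  assert (Hcoef := cubic_coefficients_zero (d 1%nat - p1) (d 2%nat - newton2 p1 p2)
    (d 3%nat - newton3 p1 p2 p3) (exp (2 * (beta + B)) + phi 1)).
  destruct Hcoef as [C1 [C2 C3]].
  { intros t Ht. assert (Ht4 : 0 <= t ^ 4) by (apply pow_le; lra).
    destruct (Hcub t ltac:(lra)) as [U1 U2].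
    assert (V := power_series_cubic_bounds d phi Hd Hser t ltac:(lra)). cbv zeta in V.
    assert (W := power_series_cubic_bounds d phi Hd Hser 1 ltac:(lra)). cbv zeta in W.
    assert (0 <= phi 1).
    { rewrite !pow1 in W. assert (Q2 := Hd 2%nat). assert (Q3 := Hd 3%nat). lra. }
    assert (0 <= t ^ 4 * phi 1) by (apply Rmult_le_pos; assumption).
    assert (He := exp_pos (2 * (beta + B))).
    assert (0 <= t ^ 4 * exp (2 * (beta + B))) by (apply Rmult_le_pos; lra).
    rewrite Hd0 in V. unfold newton_cubic in U1, U2. apply Rabs_le. split; lra. }
  assert (Ep1 : d 1%nat = p1) by lra. rewrite Ep1 in *.
  exists p2, p3. split; [lra|]. split; [lra|]. split.
  - refine (is_lim_seq_le _ (fun m => X * (beta + psum u m)) p2 (X * p1) _ L2 _).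
    + intros m. specialize (Hle2 m). assert (0 <= X * beta) by nra. lra.
    + apply is_lim_seq_mult'; [apply is_lim_seq_const|exact LP1].
  - assert (Hq : forall s, 0 <= p1 * s ^ 2 - 2 * p2 * s + p3).
    { intros s.
      refine (is_lim_seq_le (fun _ => 0) (fun m => (beta + psum u m) * s ^ 2
         - 2 * psum (fun k => u k ^ 2) m * s + psum (fun k => u k ^ 3) m)
         0 (p1 * s ^ 2 - 2 * p2 * s + p3) _ (is_lim_seq_const _) _).
      - intros m.
        assert (Hn := psum_nonneg (fun k => u k * (s - u k) ^ 2) m
          ltac:(intros k; apply Rmult_le_pos; [apply Hu0|apply pow2_ge_0])).
        rewrite psum_quadratic in Hn.
        assert (0 <= beta * s ^ 2) by (apply Rmult_le_pos; [exact Hbeta|apply pow2_ge_0]).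
        lra.
      - lim_arith. }
    (* The minimum of the quadratic in [s] is at [p2 / p1]. *)
    specialize (Hq (p2 / p1)).
    replace (p1 * (p2 / p1) ^ 2 - 2 * p2 * (p2 / p1) + p3)
      with ((p1 * p3 - p2 ^ 2) / p1) in Hq by (field; lra).
    apply (Rmult_le_compat_r p1) in Hq; [|lra].
    replace ((p1 * p3 - p2 ^ 2) / p1 * p1) with (p1 * p3 - p2 ^ 2) in Hq by (field; lra).
    lra.
Qed.

(** With [a = e1^2 / e2] and [b = e2^2 / (e1 * e3)] the first bound reads [a <= 3]
    and the second [4 <= a + 3 / b]; since [b > a], the latter implies
    [(a - 1) * (a - 3) > 0]. *)
Lemma quotients_contradiction e1 e2 e3 p2 p3 :
  0 < e1 -> 0 < e2 -> 0 < e3 ->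
  e2 = newton2 e1 p2 -> e3 = newton3 e1 p2 p3 ->
  p2 <= e2 / e1 * e1 -> p2 ^ 2 <= e1 * p3 ->
  1 < e1 ^ 2 / e2 -> e1 ^ 2 / e2 < e2 ^ 2 / (e1 * e3) -> False.
Proof.
  unfold newton2, newton3. intros H1 H2 H3 E2 E3 Hp HC Ha Hab.
  replace (e2 / e1 * e1) with e2 in Hp by (field; lra).
  assert (Ep2 : p2 = e1 ^ 2 - 2 * e2) by lra.
  assert (Ep3 : p3 = 3 * e3 + e1 ^ 3 - 3 * e1 * e2) by (subst p2; lra).
  assert (Hle : 4 * e2 ^ 2 <= 3 * (e1 * e3) + e1 ^ 2 * e2) by (subst p2 p3; lra).
  set (a := e1 ^ 2 / e2) in *. set (b := e2 ^ 2 / (e1 * e3)) in *.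
  assert (H13 : 0 < e1 * e3) by nra.
  assert (Ea : e1 ^ 2 = a * e2) by (unfold a; field; lra).
  assert (Eb : e2 ^ 2 = b * (e1 * e3)) by (unfold b; field; lra).
  assert (Ha3 : a <= 3) by (apply Rmult_le_reg_r with e2; lra).
  assert (e1 * e3 * a < e2 ^ 2) by (rewrite Eb; nra).
  assert (0 < e2 ^ 2) by nra.
  assert (4 * e2 ^ 2 * a <= 3 * (e1 * e3 * a) + a * a * e2 ^ 2).
  { replace (a * a * e2 ^ 2) with ((e1 ^ 2 * e2) * a) by (rewrite Ea; ring).
    apply Rle_trans with ((3 * (e1 * e3) + e1 ^ 2 * e2) * a); [|lra].
    apply Rmult_le_compat_r; lra. }
  assert (0 < (a * a - 4 * a + 3) * e2 ^ 2) by lra.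
  assert (0 <= (a - 1) * (3 - a)) by (apply Rmult_le_pos; lra).
  assert (0 <= (a - 1) * (3 - a) * e2 ^ 2) by (apply Rmult_le_pos; lra).
  lra.
Qed.

(** * The Laguerre-Polya class on the real line *)

Lemma Cexp_RtoC s : Cexp (RtoC s) = RtoC (exp s).
Proof. unfold Cexp, RtoC. simpl. rewrite cos_0, sin_0. f_equal; ring. Qed.

Lemma Re_scal r P : Re (RtoC r * P)%C = r * Re P.
Proof. destruct P as [x y]. simpl. ring. Qed.

Lemma zeros_prod_RtoC x m t : (forall k, 0 < x k) ->
  zeros_prod x m (RtoC t) = RtoC (linear_prod (fun k => / x k) m t).
Proof.
  intros Hx. induction m as [|m IH]; [reflexivity|].
  rewrite zeros_prod_S, IH. cbn [linear_prod]. specialize (Hx m).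
  rewrite <- RtoC_div, <- RtoC_plus, <- RtoC_mult by lra. reflexivity.
Qed.

Lemma zeros_prod_root x m k : (k < m)%nat -> 0 < x k ->
  zeros_prod x m (RtoC (- x k)) = RtoC 0.
Proof.
  intros Hk Hx. induction Hk as [|m _ IH]; rewrite zeros_prod_S.
  - replace (RtoC 1 + RtoC (- x k) / RtoC (x k))%C with (RtoC 0); [ring|].
    rewrite RtoC_opp. field. apply RtoC_neq. lra.
  - rewrite IH. ring.
Qed.

Lemma linear_prod_at_0 u m : linear_prod u m 0 = 1.
Proof. induction m as [|m IH]; simpl; [|rewrite IH]; ring. Qed.

(** Finite and infinite products are treated alike by recording the reciprocals of
    the zeros, with 0 standing for an absent factor; [B] bounds their partial
    sums. *)
Lemma LP_real_form f : LaguerrePolya_I f ->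
  exists c n beta u B, 0 <= beta /\ (forall k, 0 <= u k) /\ (forall m, psum u m <= B) /\
    (forall k, 0 < u k -> f (RtoC (- / u k)) = RtoC 0) /\
    (forall t, exists P : R, is_lim_seq (fun m => linear_prod u m t) P
       /\ Re (f (RtoC t)) = c * t ^ n * exp (beta * t) * P).
Proof.
  intros [_ [c [n [beta [x [Hb [Hx [[m Hf]|[Hs Hf]]]]]]]]].
  - exists c, n, beta, (fun k => if Nat.ltb k m then / x k else 0).
    set (u := fun k => if Nat.ltb k m then / x k else 0).
    assert (Hu : forall k, 0 <= u k).
    { intros k. unfold u. destruct (Nat.ltb k m); [|lra].
      left. apply Rinv_0_lt_compat, Hx. }
    assert (Hum : forall j, u (m + j)%nat = 0).
    { intros j. unfold u. destruct (Nat.ltb_spec (m + j) m); [lia|reflexivity]. }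
    exists (psum u m). split; [exact Hb|]. split; [exact Hu|]. split; [|split].
    + intros j. apply Rle_trans with (psum u (m + j)).
      * apply psum_mono; [exact Hu|lia].
      * induction j as [|j IH]; [rewrite Nat.add_0_r; lra|].
        rewrite Nat.add_succ_r. cbn [psum]. rewrite Hum. lra.
    + intros k Hk. unfold u in *. destruct (Nat.ltb_spec k m) as [Hkm|]; [|lra].
      rewrite Rinv_inv, Hf, zeros_prod_root by auto. ring.
    + intros t. exists (linear_prod u m t). split.
      * apply is_lim_seq_ext_loc with (fun _ => linear_prod u m t);
          [|apply is_lim_seq_const].
        exists m. intros i Hi. replace i with (m + (i - m))%nat by lia.
        generalize (i - m)%nat. intros j.
        induction j as [|j IH]; [rewrite Nat.add_0_r; reflexivity|].
        rewrite Nat.add_succ_r. cbn [linear_prod]. rewrite Hum, <- IH. ring.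
      * rewrite Hf, zeros_prod_RtoC, <- RtoC_pow, <- (RtoC_mult beta), Cexp_RtoC, <- !RtoC_mult by exact Hx.
        change (Re (RtoC ?r)) with r. f_equal.
        assert (H : forall i, (i <= m)%nat -> linear_prod (fun k => / x k) i t = linear_prod u i t).
        { induction i as [|i IH]; intros Hi; [reflexivity|]. cbn [linear_prod].

          assert (E : u i = / x i)
            by (unfold u; destruct (Nat.ltb_spec i m); [reflexivity|lia]).
          rewrite E, IH by lia. reflexivity. }
        apply H, le_n.
  - exists c, n, beta, (fun k => / x k), (Series (fun k => / x k)).
    assert (Hu : forall k, 0 < / x k) by (intros k; apply Rinv_0_lt_compat, Hx).
    split; [exact Hb|]. split; [intros k; left; apply Hu|]. split; [|split].
    + assert (H : forall m, sum_n (fun k => / x k) m <= Series (fun k => / x k)).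
      { apply is_lim_seq_incr_compare.
        - apply Series_correct in Hs. exact Hs.
        - intros m. rewrite sum_Sn. change plus with Rplus. specialize (Hu (S m)). lra. }
      assert (E : forall m, psum (fun k => / x k) (S m) = sum_n (fun k => / x k) m).
      { induction m as [|m IH]; [rewrite sum_O; simpl; ring|].
        rewrite sum_Sn, <- IH. reflexivity. }
      intros [|m]; [|rewrite E; apply H].
      specialize (H 0%nat). rewrite sum_O in H. specialize (Hu 0%nat). simpl. lra.
    + intros k _. rewrite Rinv_inv. destruct (Hf (RtoC (- x k))) as [P [HP ->]].
      replace P with (RtoC 0); [ring|]. symmetry.
      apply Clim_unique_of_eventually with (1 := filterlim_Clim _ _ HP).
      exists (S k). intros m Hm. apply zeros_prod_root; [lia|apply Hx].
    + intros t. destruct (Hf (RtoC t)) as [P [HP HE]]. exists (Re P). split.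
      * apply Clim_Re. apply filterlim_Clim in HP. eapply is_lim_seq_ext; [|exact HP].
        intros m. cbv beta. rewrite zeros_prod_RtoC by exact Hx. reflexivity.
      * rewrite HE, <- RtoC_pow, <- (RtoC_mult beta), Cexp_RtoC, <- !RtoC_mult, Re_scal.
        reflexivity.
Qed.

Lemma Re_entire_series coef f t : entire_with_coeffs coef f ->
  is_lim_seq (sum_n (fun n => coef n * t ^ n)) (Re (f (RtoC t))).
Proof.
  intros Hf. apply Clim_Re.
  eapply is_lim_seq_ext; [|exact (entire_partial_sums coef f (RtoC t) Hf)].
  intros n. cbv beta. f_equal. f_equal.
  induction n as [|n IH].
  - rewrite !sum_O, RtoC_mult, RtoC_pow. reflexivity.
  - rewrite !sum_Sn, IH. change plus with Rplus at 2.
    rewrite RtoC_plus, RtoC_mult, RtoC_pow. reflexivity.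
Qed.

(** Either a zero lies in the interval, or all reciprocals of the zeros are at most
    [a_2 / a_1] and the first power sums contradict the order of the first two
    second quotients. *)
Lemma nonpos_value_of_LP coef f :
  (forall k, 0 < coef k) -> entire_with_coeffs coef f ->
  1 < second_quotient coef 2 -> second_quotient coef 2 < second_quotient coef 3 ->
  LaguerrePolya_I f ->
  exists z0, - (coef 1%nat / coef 2%nat) <= z0 <= 0 /\ f (RtoC z0) = RtoC 0.
Proof.
  intros Hpos Hf Ha Hab HLP.
  assert (P0 := Hpos 0%nat). assert (P1 := Hpos 1%nat).
  assert (P2 := Hpos 2%nat). assert (P3 := Hpos 3%nat).
  assert (HX : 0 < coef 1%nat / coef 2%nat) by (apply Rdiv_lt_0_compat; lra).
  destruct (LP_real_form f HLP) as [c [n [beta [u [B [Hb [Hu [HB [Hroot Hprod]]]]]]]]].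
  destruct (classic (exists k, 0 < u k /\ / u k <= coef 1%nat / coef 2%nat))
    as [[k [Hk HkX]]|Hfar].
  { exists (- / u k). split; [|apply Hroot, Hk].
    assert (0 < / u k) by (apply Rinv_0_lt_compat, Hk). lra. }
  exfalso.
  assert (HuX : forall k, 0 <= u k <= coef 2%nat / coef 1%nat).
  { intros k. split; [apply Hu|]. apply Rnot_lt_le. intros Hlt. apply Hfar.
    assert (0 < coef 2%nat / coef 1%nat) by (apply Rdiv_lt_0_compat; lra).
    exists k. split; [lra|].
    replace (coef 1%nat / coef 2%nat) with (/ (coef 2%nat / coef 1%nat)) by (field; lra).
    apply Rinv_le_contravar; lra. }
  (* Comparing values at 0 shows that the factor [c * z^n] is the constant
     coefficient. *)
  assert (Hc : c * 0 ^ n = coef 0%nat).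
  { destruct (Hprod 0) as [P [HP HE]].
    assert (EP : P = 1).
    { apply (is_lim_seq_ext _ (fun _ => 1)) in HP; [|intros m; apply linear_prod_at_0].
      apply is_lim_seq_unique in HP. rewrite Lim_seq_const in HP. injection HP. auto. }
    assert (EC : Re (f (RtoC 0)) = coef 0%nat).
    { assert (H := Re_entire_series coef f 0 Hf).
      apply (is_lim_seq_ext _ (fun _ => coef 0%nat)) in H.
      - apply is_lim_seq_unique in H. rewrite Lim_seq_const in H. injection H. auto.
      - induction n0 as [|i IH]; [rewrite sum_O; simpl; ring|].
        rewrite sum_Sn, IH. change plus with Rplus. simpl. ring. }
    rewrite EP, Rmult_0_r, exp_0, EC in HE. lra. }
  assert (En : n = 0%nat).
  { destruct n as [|n]; [reflexivity|]. rewrite pow_i in Hc by lia. lra. }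
  subst n. rewrite pow_O, Rmult_1_r in Hc. subst c.
  set (d := fun k => coef k / coef 0%nat).
  destruct (product_power_sums d (fun t => / coef 0%nat * Re (f (RtoC t))) beta u
              (coef 2%nat / coef 1%nat) B) as [p2 [p3 [H2 [H3 [Hp Hq]]]]].
  - exact Hb.
  - exact HuX.
  - exact HB.
  - intros k. apply Rdiv_le_0_compat; [left; apply Hpos|lra].
  - unfold d. field. lra.
  - apply Rdiv_lt_0_compat; lra.
  - intros t _.
    apply is_lim_seq_ext with
      (fun N => / coef 0%nat * sum_n (fun k => coef k * t ^ k) N).
    + intros N. rewrite <- (sum_n_mult_l (K := R_Ring)). apply sum_n_ext. intros k.
      change (/ coef 0%nat * (coef k * t ^ k) = coef k / coef 0%nat * t ^ k).
      unfold Rdiv. ring.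
    + apply is_lim_seq_mult'; [apply is_lim_seq_const|apply Re_entire_series, Hf].
  - intros t. destruct (Hprod t) as [P [HP HE]]. exists P. split; [exact HP|].
    rewrite HE. simpl. field. lra.
  - assert (E2 : second_quotient coef 2 = d 1%nat ^ 2 / d 2%nat)
      by (unfold second_quotient, d; simpl; field; lra).
    assert (E3 : second_quotient coef 3 = d 2%nat ^ 2 / (d 1%nat * d 3%nat))
      by (unfold second_quotient, d; simpl; field; lra).
    apply (quotients_contradiction (d 1%nat) (d 2%nat) (d 3%nat) p2 p3);
      try assumption; try (apply Rdiv_lt_0_compat; lra).
    + replace (d 2%nat / d 1%nat) with (coef 2%nat / coef 1%nat); [exact Hp|].
      unfold d. field. lra.
    + rewrite <- E2. exact Ha.
    + rewrite <- E2, <- E3. exact Hab.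
Qed.

Theorem theorem1p1 (coef : nat -> R) (f : C -> C) (a b : R)
  (coef_pos : forall k : nat, 0 < coef k)
  (f_entire : entire_with_coeffs coef f)
  (a_gt1 : 1 < a) (a_lt_b : a < b)
  (q_even : forall j : nat, (1 <= j)%nat -> second_quotient coef (2 * j) = a)
  (q_odd : forall j : nat, (1 <= j)%nat -> second_quotient coef (2 * j + 1) = b) :
  LaguerrePolya_I f <->
  (exists z0 : R,
     - (coef 1%nat / coef 2%nat) <= z0 <= 0 /\
     (exists y : R, f (RtoC z0) = RtoC y /\ y <= 0)).
Proof.
  split.
  - intros HLP. assert (H2 := q_even 1%nat (le_n _)). assert (H3 := q_odd 1%nat (le_n _)).
    simpl in H2, H3.
    destruct (nonpos_value_of_LP coef f coef_pos f_entire) as [z0 [Hz Hf0]];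
      [rewrite H2; exact a_gt1|rewrite H2, H3; exact a_lt_b|exact HLP|].
    exists z0. split; [exact Hz|]. exists 0. split; [exact Hf0|lra].
  - intros [z0 [Hz [y [Hy Hy0]]]].
    exact (LP_of_nonpos_value coef f a b z0 y coef_pos f_entire a_gt1 a_lt_b
             q_even q_odd Hz Hy Hy0).
Qed.
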